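(* Let $(Z_n)_{n\in\mathbb N}$ be a real-valued stochastic process satisfying the moment conditions (M1), (M2), (M3) stated in the context, let $\varphi_N$ ($N\in\mathbb N$) be fillings, let $X_N\in\mathbb R^{N\times N}$ be the symmetric random matrix generated by $(Z_n)_n$ and $\varphi_N$, and let $A_N(i,j):=\frac1{\sqrt N}X_N(i,j)$. Assume: (i) there exists $c>0$ such that $J(\varphi_N)\ge cN^2$ for all $N\ge2$; (ii) there exist $\beta\in(0,1)$ and $C>0$ such that for all $i_1\le i_2\le i_3\le i_4$, with $n_j:=i_{j+1}-i_j$, one has $\mathbb E(Z_{i_1}Z_{i_2}Z_{i_3}Z_{i_4})=C\beta^{n_1+n_3}$ and $\mathbb E(Z_{i_1}^2Z_{i_2}^2)=1$. Then $\mathbb E\left(\frac1N\operatorname{tr}A_N^4\right)$ does not converge to $\kappa_2=2$ as $N\to\infty$. Hence the empirical spectral distribution $\mu_N=\frac1N\sum_{k=1}^N\delta_{\lambda_k^{(N)}}$ of $A_N$ (where $\lambda_1^{(N)}\le\dots\le\lambda_N^{(N)}$ are the eigenvalues of $A_N$) does not converge weakly in probability to the semicircle law $\nu(dx)=\frac1{2\pi}\sqrt{4-x^2}\,\mathbf 1_{|x|\le2}\,dx$.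
   Context: Filling: for each $N$, a filling is a bijection $\varphi_N:\{1,\dots,N(N+1)/2\}\to\{(i,j)\in\{1,\dots,N\}^2: i\le j\}$. The symmetric matrix $X_N\in\mathbb R^{N\times N}$ generated by $(Z_n)_n$ and $\varphi_N$ has entries $X_N(i,j)=X_N(j,i)=Z_{\varphi_N^{-1}(i,j)}$ for $1\le i\le j\le N$. Neighbors: indices $(i,j),(i',j')\in\{1,\dots,N\}^2$ with $i\le j$, $i'\le j'$ are called neighbors if either $i=i'$ and $j\in\{j'+1,j'-1\}$ (horizontal), or $j=j'$ and $i\in\{i'+1,i'-1\}$ (vertical). Set $J(\varphi_N):=\#\{1\le i<\frac{N(N+1)}2:\varphi_N(i)\text{ and }\varphi_N(i+1)\text{ are neighbors}\}$. $\kappa_k:=\frac1{k+1}\binom{2k}{k}$ are the Catalan numbers; $\int x^4\,d\nu=\kappa_2=2$. Moment conditions on $(Z_n)_n$ (all expectations that appear are assumed to exist; convention $0^0=1$): (M1) $\mathbb E(Z_i^2)=1$ for all $i\in\mathbb N$. (M2) For all odd $k$ and all $i_1,\dots,i_k\in\mathbb N$: $\mathbb E(Z_{i_1}Z_{i_2}\cdots Z_{i_k})=0$. (M3) For all even $k$ there are constants $C>0$ and $\beta\in[0,1)$ such that for all $i_1\le i_2\le\dots\le i_k$, with $n_j:=i_{j+1}-i_j$: (a) $|\mathbb E(Z_{i_1}\cdots Z_{i_k})|\le C\beta^{n_1+n_3+\dots+n_{k-1}}$; (b) for all $j_1\le\dots\le j_k$, with $d:=\min_{n,m\in\{1,\dots,k\}}|i_n-j_m|$: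 $|\mathbb E(Z_{i_1}\cdots Z_{i_k}Z_{j_1}\cdots Z_{j_k})-\mathbb E(Z_{i_1}\cdots Z_{i_k})\mathbb E(Z_{j_1}\cdots Z_{j_k})|\le C\beta^d$; (c) with $d':=\min_{j=1,3,5,\dots,k-3}(i_{j+2}-i_j)$: $|\mathbb E(Z_{i_1}^2Z_{i_3}^2\cdots Z_{i_{k-1}}^2)-1|\le C\beta^{d'}$ (for $k=2$ the minimum is empty and (c) is contained in (M1)). (The constants in (M3) may depend on $k$ and need not be those in (ii).) Weak convergence in probability means: for every bounded continuous $f:\mathbb R\to\mathbb R$, $\int f\,d\mu_N\to\int f\,d\nu$ in probability. *)

(* Defs.v *)
From HB Require Import structures.
From mathcomp Require Import all_boot all_order all_algebra.
From mathcomp Require Import all_classical all_reals all_analysis measurable_realfun.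
From mathcomp Require sesquilinear spectral complex.

Set Implicit Arguments.
Unset Strict Implicit.
Unset Printing Implicit Defensive.

Import Order.TTheory GRing.Theory Num.Theory.
Import numFieldNormedType.Exports.

Local Open Scope classical_set_scope.
Local Open Scope ring_scope.

(* Every index range {1, ..., n} of the mathematics is shifted to {0, ..., n-1}:
   the process, the row and column indices and the domain of a filling all start
   at 0. All the conditions below only involve differences of indices. *)

Definition upper_idx (N : nat) := {p : 'I_N * 'I_N | (p.1 <= p.2)%N}.

Record filling (N : nat) := Filling {
  fill :> 'I_(N * N.+1)./2 -> upper_idx N;
  fill_inv : upper_idx N -> 'I_(N * N.+1)./2;
  fillK : cancel fill fill_inv;
  fill_invK : cancel fill_inv fill
}.

Lemma ord_minmax_le (N : nat) (i j : 'I_N) :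
  ((Order.min i j, Order.max i j).1 <= (Order.min i j, Order.max i j).2)%N.
Proof. by rewrite /= minElt maxElt; case: ltP => [/ltW|]. Qed.

Definition upper_pair (N : nat) (i j : 'I_N) : upper_idx N :=
  exist _ (Order.min i j, Order.max i j) (ord_minmax_le i j).

Definition neighbors (N : nat) (p q : upper_idx N) : bool :=
  let: (i, j) := val p in let: (i', j') := val q in
  (i == i') && ((j == j'.+1 :> nat) || (j' == j.+1 :> nat)) ||
  (j == j') && ((i == i'.+1 :> nat) || (i' == i.+1 :> nat)).

Definition num_neighbors (N : nat) (phi : filling N) : nat :=
  #|[pred k : 'I_(N * N.+1)./2 |
      [exists l : 'I_(N * N.+1)./2,
        (l == k.+1 :> nat) && neighbors (phi k) (phi l)]]|.

(* Only used on nonempty sequences; 0 on the empty one. *)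
Definition seq_min (s : seq nat) : nat := foldr minn (head 0%N s) s.

Section Process.
Context (d : measure_display) (T : measurableType d) (R : realType).
Context (P : probability T R) (Z : nat -> {RV P >-> R}).

Definition moment (s : seq nat) : \bar R :=
  ('E_P[fun w => (\prod_(i <- s) Z i w)%R])%E.

Definition moments_exist : Prop :=
  forall s : seq nat,
    P.-integrable setT (fun w => (\prod_(i <- s) Z i w)%:E).

Definition condM1 : Prop := forall i : nat, ('E_P[fun w => (Z i w ^+ 2)%R] = 1)%E.

Definition condM2 : Prop := forall s : seq nat, odd (size s) -> moment s = 0%E.

(* n_1 + n_3 + ... + n_{k-1} for the sequence s = (i_1, ..., i_k) of even size *)
Definition gap_sum (s : seq nat) : nat :=
  (\sum_(j < (size s)./2) (nth 0 s j.*2.+1 - nth 0 s j.*2))%N.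

Definition seq_dist (s t : seq nat) : nat :=
  seq_min [seq `|x%:Z - y%:Z|%N | x <- s, y <- t].

(* the minimum of the i_{j+2} - i_j, j = 1, 3, ..., k - 3, where k = size s *)
Definition min_gap2 (s : seq nat) : nat :=
  seq_min [seq (nth 0 s j.*2.+2 - nth 0 s j.*2)%N | j <- iota 0 (size s)./2.-1].

Definition condM3a (k : nat) (C b : R) : Prop :=
  forall s : k.-tuple nat, sorted leq s ->
    (`|moment s| <= (C * b ^+ gap_sum s)%:E)%E.

Definition condM3b (k : nat) (C b : R) : Prop :=
  forall s t : k.-tuple nat, sorted leq s -> sorted leq t ->
    (`|moment (s ++ t) - moment s * moment t| <= (C * b ^+ seq_dist s t)%:E)%E.

Definition condM3c (k : nat) (C b : R) : Prop :=
  (2 < k)%N -> forall s : k.-tuple nat, sorted leq s ->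
    (`|'E_P[fun w => (\prod_(j < k./2) Z (nth 0%N s j.*2) w ^+ 2)%R] - 1| <=
     (C * b ^+ min_gap2 s)%:E)%E.

Definition condM3 : Prop :=
  forall k : nat, (0 < k)%N -> ~~ odd k ->
    exists C b : R, [/\ 0 < C, 0 <= b < 1,
      condM3a k C b, condM3b k C b & condM3c k C b].

Definition gen_matrix (N : nat) (phi : filling N) (w : T) : 'M[R]_N :=
  \matrix_(i, j) Z (fill_inv phi (upper_pair i j)) w.

Definition scaled_matrix (N : nat) (phi : filling N) (w : T) : 'M[R]_N :=
  (Num.sqrt N%:R)^-1 *: gen_matrix phi w.

Definition cvg_in_probability (Y : nat -> T -> R) (c : R) : Prop :=
  forall eps : R, 0 < eps ->
    P [set w | eps < `|Y N w - c|] @[N --> \oo] --> 0%E.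

Definition weak_cvg_in_probability
    (mu : nat -> T -> {measure set R -> \bar R})
    (nu : {measure set R -> \bar R}) : Prop :=
  forall f : R -> R, continuous f -> bounded_fun f ->
    cvg_in_probability (fun N w => \int[mu N w]_x f x) (\int[nu]_x f x).

End Process.

Definition is_spectrum (R : realType) (N : nat) (A : 'M[R]_N)
    (l : N.-tuple R) : Prop :=
  sorted <=%R l /\ char_poly A = \prod_(x <- l) ('X - x%:P).

Lemma is_spectrum_unique (R : realType) (N : nat) (A : 'M[R]_N)
    (l l' : N.-tuple R) :
  is_spectrum A l -> is_spectrum A l' -> l = l'.
Proof.
move=> [sl el] [sl' el']; apply/val_inj/(sorted_eq le_trans le_anti sl sl').
by apply: prod_XsubC_eq; rewrite -el -el'.
Qed.

Lemma char_poly_conjugate (F : fieldType) (N : nat) (Q D : 'M[F]_N) :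
  Q \in unitmx -> char_poly (invmx Q *m D *m Q) = char_poly D.
Proof.
move=> Qu; pose Q' := map_mx polyC Q; pose V' := map_mx polyC (invmx Q).
have VQ : V' *m Q' = 1%:M by rewrite -map_mxM mulVmx// map_mx1.
rewrite /char_poly.
suff -> : char_poly_mx (invmx Q *m D *m Q) = V' *m char_poly_mx D *m Q'.
  by rewrite !det_mulmx mulrAC -det_mulmx VQ det1 mul1r.
rewrite /char_poly_mx mulmxBr mulmxBl -!map_mxM; congr (_ - _).
by rewrite scalar_mxC -mulmxA VQ mulmx1.
Qed.

Section SpectrumExists.
Import sesquilinear spectral complex.

Lemma is_spectrum_exists (R : realType) (N : nat) (A : 'M[R]_N) :
  A^T = A -> exists l, is_spectrum A l.
Proof.
move=> symA; pose toC : {rmorphism R -> R[i]} :=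
  [the {rmorphism R -> R[i]} of real_complex R].
pose B := map_mx toC A.
have realB : B \is a mxOver Num.real.
  by apply/mxOverP => i j; rewrite mxE; apply/complex_realP; exists (A i j).
have hermB : B \is hermitianmx N false Num.conj.
  apply: realsym_hermsym => //.
  apply/is_hermitianmxP.
  by rewrite expr0 scale1r map_mx_id// map_trmx symA.
have realD := hermitian_spectral_diag_real hermB.
have /hermitian_normalmx /orthomx_spectralP eqB := hermB.
pose D i := Re (spectral_diag B 0 i).
have DE i : spectral_diag B 0 i = toC (D i).
  by rewrite /D /= RRe_real//; move/mxOverP: realD.
have pA : char_poly A = \prod_i ('X - (D i)%:P).
  apply: (map_poly_inj toC); rewrite map_char_poly -/B eqB.
  rewrite char_poly_conjugate ?spectral_unit//.
  rewrite char_poly_trig ?diag_mx_is_trig// rmorph_prod/=.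
  apply: eq_bigr => i _.
  by rewrite rmorphB/= map_polyX map_polyC/= !mxE eqxx mulr1n DE.
exists (sort_tuple <=%R [tuple D i | i < N]); split.
  exact/sort_sorted/le_total.
rewrite pA (perm_big _ (permEl (perm_sort _ _)))/=.
by rewrite big_map -big_enum.
Qed.

End SpectrumExists.

Section Spectrum.
Context (R : realType).

(* The eigenvalues, with multiplicity and in nondecreasing order; a junk value
   when the characteristic polynomial does not split over R. *)
Definition eigenvalues (N : nat) (A : 'M[R]_N) : N.-tuple R :=
  xget [tuple 0 | _ < N] [set l | is_spectrum A l].

Lemma eigenvaluesP (N : nat) (A : 'M[R]_N) :
  A^T = A -> is_spectrum A (eigenvalues A).
Proof. by move=> /is_spectrum_exists[l Al]; exact: (xgetI _ Al). Qed.

Definition esd (N : nat) (A : 'M[R]_N)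
    : {measure set R -> \bar R} :=
  [the {measure set R -> \bar R} of
    mscale (N%:R^-1)%:nng (msum (fun k => \d_(nth 0 (eigenvalues A) k)) N)].

End Spectrum.

Section Semicircle.
Context (R : realType).

Definition semicircle_pdf (x : R) : R :=
  (2 * pi)^-1 * Num.sqrt (4 - x ^+ 2) * \1_`[-2, 2] x.

Definition semicircle : set R -> \bar R :=
  fun V => (\int[lebesgue_measure]_(x in V) (semicircle_pdf x)%:E)%E.

Lemma semicircle_pdf_ge0 x : 0 <= semicircle_pdf x.
Proof.
by rewrite !mulr_ge0 ?sqrtr_ge0 ?ler0n// invr_ge0 mulr_ge0// pi_ge0.
Qed.

Lemma measurable_semicircle_pdf : measurable_fun setT semicircle_pdf.
Proof.
apply: measurable_funM; last exact: measurable_indic.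
apply: measurable_funM => //; apply: measurableT_comp => //.
  exact: (continuous_measurable_fun (@sqrt_continuous R)).
by apply: measurable_funB => //; exact: measurable_funX.
Qed.

Let semicircle0 : semicircle set0 = 0%E.
Proof. by rewrite /semicircle integral_set0. Qed.

Let semicircle_ge0 V : (0 <= semicircle V)%E.
Proof. by apply: integral_ge0 => x _; rewrite lee_fin semicircle_pdf_ge0. Qed.

Let semicircle_sigma_additive : semi_sigma_additive semicircle.
Proof.
move=> /= A mA tA mUA; rewrite /semicircle ge0_integral_bigcup//=; last 2 first.
- apply/measurable_EFinP/measurable_funTS; exact: measurable_semicircle_pdf.
- by move=> x _; rewrite lee_fin semicircle_pdf_ge0.
apply: is_cvg_ereal_nneg_natsum_cond => n _ _; exact: semicircle_ge0.
Qed.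

HB.instance Definition _ := isMeasure.Build _ _ _ semicircle
  semicircle0 semicircle_ge0 semicircle_sigma_additive.

Definition catalan (k : nat) : R := 'C(k.*2, k)%:R / k.+1%:R.

End Semicircle.

(* Main.v *)
Require Import Defs.
From mathcomp Require Import all_boot all_order all_algebra.
From mathcomp Require Import all_classical all_reals all_analysis.
From mathcomp Require Import measurable_realfun.
From mathcomp Require Import ring lra zify.
From mathcomp Require sesquilinear spectral complex.

(** The hypothesis on the fourth moments determines them completely: its
    constant is [1], and an expectation of four variables is [b] to the sum of
    the two outer gaps of the sorted indices. In particular no closed walk of
    length four has a negative expectation.

    Expand the expected trace of the fourth power of the matrix over closed
    walks [i, j, k, l, i]. The walks with [i = k] or [j = l] contribute
    [2 N ^ 3] to leading order, which is the semicircle value [2]. If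
    [k = i + 1] and the entries of both columns [j] and [l] in the rows [i] and
    [k] are filled at consecutive times, then the walk has expectation at least
    [b ^ 2]. As there are at least [c N ^ 2] consecutively filled neighbors,
    convexity gives at least [c ^ 2 N ^ 3] such walks, up to lower order. Hence
    the normalized fourth moment eventually exceeds [2 + delta] for some
    [delta > 0] ([mom_cycle_ge], [trace4_ge], [fourth_moment_gap]), and it does
    not converge to [2].

    Weak convergence in probability alone does not control fourth moments: a
    vanishing fraction of large eigenvalues could carry the surplus. This is
    excluded by a uniform bound on the expected eighth moment. The decay of
    the moments in the gaps of the sorted indices bounds each of them by a sum
    over the pairings of the steps of a walk, and a closed walk of length [2m]
    whose steps are tied in pairs has only [m + 1] free vertices
    ([expr_gap_sum_le], [sum_walks_pairing], [trace_even_moment_le]).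

    So let [cap e x = x ^ 4 / (1 + e x ^ 4)], a bounded continuous function
    with [x ^ 4 <= cap e x + e x ^ 8]. Its integral under the semicircle law is
    at most the fourth moment of that law, which is [2]
    ([semicircle_Rintegral_le]). If the spectral distributions converged weakly
    in probability, the expected integrals of [cap e] would eventually be at
    most [2] up to an arbitrarily small error, and for small [e] the
    expected fourth moment would stay below [2 + delta]
    ([expectation_fourth_moment_le]). Passing from convergence in probability
    to expectations requires the deviation events to be measurable; this holds
    because the integral of [cap e] against the spectral distribution is the
    trace of a rational function of the matrix ([trace_cap_eigenvalues]). *)

Set Implicit Arguments.
Unset Strict Implicit.
Unset Printing Implicit Defensive.

Import Order.TTheory GRing.Theory Num.Theory.
Import numFieldNormedType.Exports.

Local Open Scope classical_set_scope.
Local Open Scope ring_scope.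

(** * Walks and traces of powers *)

Definition walks (N n : nat) : seq (seq 'I_N) :=
  iter n (fun W => [seq rcons s v | s <- W, v <- enum 'I_N]) [:: [::]].

Arguments walks : simpl never.

(** Walks grow at their end, so sums over walks are estimated one vertex at a
    time, the last vertex being summed out first. *)
Lemma sum_walksS (V : nmodType) (N n : nat) (g : seq 'I_N -> V) :
  \sum_(s <- walks N n.+1) g s = \sum_(s <- walks N n) \sum_v g (rcons s v).
Proof.
by rewrite big_allpairs_dep; apply: eq_bigr => s _; rewrite big_enum.
Qed.

Lemma size_walks (N n : nat) (s : seq 'I_N) : s \in walks N n -> size s = n.
Proof.
elim: n s => [|n IH] s; first by rewrite inE => /eqP ->.
by case/allpairsP => -[u v] /= [/IH <- _ ->]; rewrite size_rcons.
Qed.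

Definition steps (N : nat) (x0 : 'I_N) (pos : 'I_N -> 'I_N -> nat) (n : nat)
    (s : seq 'I_N) : seq nat :=
  [seq pos (nth x0 s a) (nth x0 s a.+1) | a <- iota 0 n].

Lemma mx_exp_walks (R : pzRingType) (N : nat) (x0 : 'I_N) (X : 'M[R]_N)
    (n : nat) (i j : 'I_N) :
  (X ^+ n) i j = \sum_(s <- walks N n.+1)
    ((nth x0 s 0 == i)%:R * (nth x0 s n == j)%:R *
     \prod_(a <- iota 0 n) X (nth x0 s a) (nth x0 s a.+1)).
Proof.
elim: n i j => [|n IH] i j.
  rewrite expr0 sum_walksS /walks/= big_seq1 mxE (bigD1 i)//= eqxx mul1r.
  rewrite big_nil mulr1 big1 ?addr0// => v /negPf ->; by rewrite !mul0r.
rewrite exprSr -mulmxE mxE sum_walksS.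
under eq_bigr do rewrite IH mulr_suml.
rewrite exchange_big big_seq [RHS]big_seq; apply: eq_bigr => s /size_walks ss.
have prodS v : \prod_(a <- iota 0 n.+1)
      X (nth x0 (rcons s v) a) (nth x0 (rcons s v) a.+1) =
    (\prod_(a <- iota 0 n) X (nth x0 s a) (nth x0 s a.+1)) * X (nth x0 s n) v.
  rewrite -addn1 iotaD big_cat big_seq1 add0n !nth_rcons ss ltnn eqxx ltnSn.
  congr (_ * _); rewrite big_seq [RHS]big_seq; apply: eq_bigr => a.
  by rewrite mem_iota add0n /= => an; rewrite !nth_rcons ss !ltnS an ltnW.
under [RHS]eq_bigr do rewrite prodS !nth_rcons ss ltn0Sn ltnn eqxx.
rewrite (bigD1 (nth x0 s n))//= [X in _ + X]big1 ?addr0; last first.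
  by move=> l /negPf; rewrite eq_sym => ->; rewrite mulr0 !mul0r.
rewrite (bigD1 j)//= [X in _ = _ + X]big1 ?addr0; last first.
  by move=> l /negPf lj; rewrite lj mulr0 !mul0r.
by rewrite !eqxx !mulr1 mulrA.
Qed.

Lemma trace_exp_walks (R : pzRingType) (N : nat) (x0 : 'I_N) (X : 'M[R]_N)
    (n : nat) :
  \tr (X ^+ n) = \sum_(s <- walks N n.+1 | nth x0 s 0 == nth x0 s n)
     \prod_(a <- iota 0 n) X (nth x0 s a) (nth x0 s a.+1).
Proof.
rewrite /mxtrace; under eq_bigr do rewrite (mx_exp_walks x0).
rewrite exchange_big [RHS]big_mkcond; apply: eq_bigr => s _ /=.
rewrite -mulr_suml (bigD1 (nth x0 s 0))//= eqxx mul1r big1 ?addr0.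
  by rewrite eq_sym; case: eqP => _; rewrite ?mul1r ?mul0r.
by move=> l /negPf; rewrite eq_sym => ->; rewrite mul0r.
Qed.

(** * Geometric weights and pairings *)

(** The distance [|p - q|]: at most one truncated difference is nonzero. *)
Definition gap (p q : nat) : nat := ((p - q) + (q - p))%N.

Section Geometric.
Context (R : realFieldType) (b : R).
Hypothesis b01 : 0 <= b < 1.

Let b0 : 0 <= b. Proof. by case/andP: b01. Qed.
Let b1 : b < 1. Proof. by case/andP: b01. Qed.

(** Distinct exponents only select some terms of the geometric series. *)
Lemma sum_expr_uniq (u : seq nat) :
  uniq u -> \sum_(k <- u) b ^+ k <= (1 - b)^-1.
Proof.
move=> uu; have [B uB] : exists B, {subset u <= iota 0 B}.
  exists (\max_(k <- u) k).+1 => k ku.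
  by rewrite mem_iota/= add0n ltnS; exact: leq_bigmax_seq.
apply: (@le_trans _ _ (\sum_(k <- iota 0 B) b ^+ k)).
  rewrite (perm_big [seq k <- iota 0 B | k \in u])/=; last first.
    apply: uniq_perm => //; first by rewrite filter_uniq// iota_uniq.
    by move=> k; rewrite mem_filter; case ku: (k \in u) => //=; rewrite uB.
  rewrite big_filter [leRHS](bigID (mem u))/= lerDl.
  by rewrite sumr_ge0// => k _; rewrite exprn_ge0.
have -> : \sum_(k <- iota 0 B) b ^+ k = \sum_(k < B) b ^+ k.
  by rewrite -(big_mkord xpredT (fun k => b ^+ k)) /index_iota subn0.
have -> : \sum_(k < B) b ^+ k = (1 - b ^+ B) / (1 - b).
  by rewrite -opprB subrX1 -mulNr opprB mulrC mulKf// subr_eq0 gt_eqF.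
by rewrite ler_piMl ?invr_ge0 ?subr_ge0 ?(ltW b1)// gerBl exprn_ge0.
Qed.

(** On either side of [p] the distances to [p] are distinct, so each side
    contributes at most one geometric series. *)
Lemma sum_gap_le (I : finType) (f : I -> nat) (p : nat) :
  injective f -> \sum_v b ^+ gap p (f v) <= 2 / (1 - b).
Proof.
move=> finj; rewrite (bigID (fun v => (f v <= p)%N))/= mulr_natl mulr2n.
have big_le (P : pred I) (h : nat -> nat) :
    {in [pred v | P v] &, injective (fun v => h (f v))} ->
    (forall v, P v -> gap p (f v) = h (f v)) ->
    \sum_(v | P v) b ^+ gap p (f v) <= (1 - b)^-1.
  move=> hinj hE; under eq_bigr => v Pv do rewrite (hE v Pv).
  rewrite -big_filter -(big_map (fun v => h (f v)) xpredT (fun k => b ^+ k)).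
  apply: sum_expr_uniq; rewrite map_inj_in_uniq ?filter_uniq ?index_enum_uniq//.
  by move=> u v; rewrite !mem_filter => /andP[Pu _] /andP[Pv _]; exact: hinj.
apply: lerD.
- apply: (big_le _ (fun q => p - q)%N) => [u v|v]; rewrite ?inE.
    by move=> up vp /= e; apply: finj; lia.
  by move=> vp; rewrite /gap; lia.
- apply: (big_le _ (fun q => q - p)%N) => [u v|v]; rewrite ?inE.
    by move=> up vp /= e; apply: finj; lia.
  by move=> vp; rewrite /gap; lia.
Qed.

End Geometric.

Section Walks.
Context (R : realFieldType) (b : R) (N : nat) (x0 : 'I_N).
Context (pos : 'I_N -> 'I_N -> nat).
Hypotheses (b01 : 0 <= b < 1) (pos_inj : forall i, injective (pos i)).

(** The weight of a sequence of positions [q] for a list [M] of pairs of indices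
    that are matched together; closely matched positions weigh most. *)
Definition pairing_weight (M : seq (nat * nat)) (q : seq nat) : R :=
  \prod_(e <- M) b ^+ gap (nth 0%N q e.1) (nth 0%N q e.2).

Lemma pairing_weight_ge0 M q : 0 <= pairing_weight M q.
Proof.
rewrite /pairing_weight prodr_ge0// => e _.
by case/andP: b01 => *; exact: exprn_ge0.
Qed.

Lemma steps_rcons n s v : size s = n.+1 ->
  steps x0 pos n.+1 (rcons s v) =
  rcons (steps x0 pos n s) (pos (nth x0 s n) v).
Proof.
move=> ss; rewrite /steps -addn1 iotaD map_cat/= cats1 add0n.
rewrite !nth_rcons ss ltnSn ltnn eqxx; congr rcons.
apply/eq_in_map => a; rewrite mem_iota add0n /= => an.
by rewrite !nth_rcons ss !ltnS an ltnW.
Qed.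

Lemma size_steps n s : size (steps x0 pos n s) = n.
Proof. by rewrite size_map size_iota. Qed.

(** Sum out the last vertex of the walk. If the last step is the later member
    of a pair, then the last vertex determines its position injectively and the
    sum is at most a geometric constant; if it is unmatched, the last vertex is
    free and costs a factor [N]. A perfect pairing of [2m] steps therefore
    leaves only [m + 1] free vertices. *)
Lemma sum_walks_pairing n (M : seq (nat * nat)) :
  {in M, forall e, (e.1 < e.2 < n)%N} -> uniq (unzip2 M) ->
  \sum_(s <- walks N n.+1) pairing_weight M (steps x0 pos n s) <=
  (2 / (1 - b)) ^+ size M * N%:R ^+ (n.+1 - size M).
Proof.
elim: n M => [|n IH] M Mn uM.
  case: M Mn uM => [|e M Mn _]; last first.
    by have := Mn e (mem_head _ _); rewrite ltn0 andbF.
  move=> _ _; rewrite sum_walksS /walks/= big_seq1 subn0 expr1 expr0 mul1r.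
  under eq_bigr do rewrite /pairing_weight big_nil.
  by rewrite sumr_const card_ord.
have K0 : 0 <= 2 / (1 - b).
  by case/andP: b01 => _ b1; rewrite divr_ge0// subr_ge0 ltW.
have weight_rcons M' s v : size s = n.+1 ->
    {in M', forall e, (e.1 < e.2 < n)%N} ->
    pairing_weight M' (steps x0 pos n.+1 (rcons s v)) =
    pairing_weight M' (steps x0 pos n s).
  move=> ss M'n; rewrite steps_rcons// /pairing_weight big_seq [RHS]big_seq.
  apply: eq_bigr => e /M'n /andP[e12 e2n].
  by rewrite !nth_rcons size_steps e2n (ltn_trans e12).
rewrite sum_walksS; have [|nM] := boolP (n \in unzip2 M).
(* the last step is matched with an earlier step c *)
- case/mapP => -[c a] cM /= na; rewrite -{a}na in cM.
  have pM := perm_to_rem cM; set M' := rem _ M in pM.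
  have uM' : uniq (unzip2 ((c, n) :: M')).
    by rewrite -(perm_uniq (perm_map snd pM)).
  case/andP: uM' => nM' uM'.
  have cn : (c < n)%N by have := Mn _ cM; rewrite /= => /andP[].
  have M'n : {in M', forall e, (e.1 < e.2 < n)%N}.
    move=> e eM'; have /Mn/andP[-> /=] : e \in M.
      by rewrite (perm_mem pM) inE eM' orbT.
    rewrite ltnS leq_eqVlt => /orP[/eqP en|//].
    by case/negP: nM'; rewrite -en; exact: (map_f snd eM').
  rewrite (perm_size pM)/= subSS exprS -mulrA.
  apply: le_trans (ler_wpM2l K0 (IH _ M'n uM')).
  rewrite mulr_sumr big_seq [leRHS]big_seq; apply: ler_sum => s /size_walks ss.
  under eq_bigr => v _.
    rewrite /pairing_weight (perm_big _ pM) big_cons /= -/(pairing_weight _ _).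
    rewrite weight_rcons// steps_rcons// !nth_rcons size_steps cn ltnn eqxx.
    over.
  rewrite -mulr_suml ler_wpM2r ?pairing_weight_ge0//.
  by apply: sum_gap_le => //; exact: pos_inj.
- have M'n : {in M, forall e, (e.1 < e.2 < n)%N}.
    move=> e eM; have /andP[-> /=] := Mn _ eM.
    rewrite ltnS leq_eqVlt => /orP[/eqP en|//].
    by case/negP: nM; rewrite -en; exact: (map_f snd eM).
  have sM : (size M <= n)%N.
    rewrite -(size_map snd) -(size_iota 0 n); apply: uniq_leq_size => // a.
    by case/mapP => e /M'n /andP[_ en] ->; rewrite mem_iota.
  rewrite subSn ?(leq_trans sM)// exprSr mulrA.
  apply: le_trans (ler_wpM2r (ler0n _ N) (IH _ M'n uM)).
  rewrite mulr_suml big_seq [leRHS]big_seq; apply: ler_sum => s /size_walks ss.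
  under eq_bigr => v _ do rewrite weight_rcons//.
  by rewrite sumr_const card_ord mulr_natr.
Qed.

End Walks.

(** Consecutive entries of [L] are matched. Each pair is listed with its smaller
    index first, because walks are summed out from their last step. *)
Definition pairing (m : nat) (L : seq nat) : seq (nat * nat) :=
  [seq (minn (nth 0 L j.*2) (nth 0 L j.*2.+1),
        maxn (nth 0 L j.*2) (nth 0 L j.*2.+1))%N | j <- iota 0 m].

Lemma size_pairing m L : size (pairing m L) = m.
Proof. by rewrite size_map size_iota. Qed.

Lemma pairing_lt m L : perm_eq L (iota 0 m.*2) ->
  {in pairing m L, forall e, (e.1 < e.2 < m.*2)%N}.
Proof.
move=> pL _ /mapP[j jm ->] /=; rewrite mem_iota add0n /= in jm.
have uL : uniq L by rewrite (perm_uniq pL) iota_uniq.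
have sL : size L = m.*2 by rewrite (perm_size pL) size_iota.
have L_lt i : (i < m.*2)%N -> (nth 0 L i < m.*2)%N.
  have := mem_nth 0%N (s := L); move/(_ i).
  by rewrite sL (perm_mem pL) mem_iota add0n => /[apply].
have h1 := L_lt j.*2; have h2 := L_lt j.*2.+1.
have: nth 0%N L j.*2 <> nth 0%N L j.*2.+1.
  by move/eqP; rewrite nth_uniq ?sL//; lia.
lia.
Qed.

Lemma pairing_uniq m L : perm_eq L (iota 0 m.*2) -> uniq (unzip2 (pairing m L)).
Proof.
move=> pL; rewrite /unzip2 -map_comp map_inj_in_uniq ?iota_uniq// => i j.
rewrite !mem_iota !add0n /= => im jm.
have uL : uniq L by rewrite (perm_uniq pL) iota_uniq.
have sL : size L = m.*2 by rewrite (perm_size pL) size_iota.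
have inj k l : (k < m.*2)%N -> (l < m.*2)%N ->
    nth 0%N L k = nth 0%N L l -> k = l.
  by move=> km lm /eqP; rewrite nth_uniq ?sL// => /eqP.
have := inj i.*2 j.*2; have := inj i.*2.+1 j.*2.
have := inj i.*2 j.*2.+1; have := inj i.*2.+1 j.*2.+1.
lia.
Qed.

(** Sorting [q] applies some permutation of its indices, and matching
    consecutive indices of that permutation produces exactly the gaps of the
    sorted sequence; the other permutations only add nonnegative terms. This
    trades the order statistics for pairings that do not depend on [q]. *)
Lemma expr_gap_sum_le (R : realFieldType) (b : R) m (q : seq nat) :
  0 <= b < 1 -> size q = m.*2 ->
  b ^+ gap_sum (sort leq q) <=
  \sum_(L <- permutations (iota 0 m.*2)) pairing_weight b (pairing m L) q.
Proof.
move=> b01 sq; pose L := sort (relpre (nth 0%N q) leq) (iota 0 m.*2).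
have pL : perm_eq L (iota 0 m.*2) by rewrite perm_sort.
have LP : L \in permutations (iota 0 m.*2) by rewrite mem_permutations.
have qL : sort leq q = [seq nth 0%N q i | i <- L].
  by rewrite -sort_map map_nth_iota0 ?sq// -sq take_size.
rewrite (big_rem _ LP)/= ler_wpDr ?sumr_ge0//.
  by move=> M _; exact: pairing_weight_ge0.
rewrite /pairing_weight /pairing big_map /gap_sum size_sort sq doubleK.
rewrite expr_sum -(big_mkord xpredT (fun j => b ^+
  (nth 0%N (sort leq q) j.*2.+1 - nth 0%N (sort leq q) j.*2)%N)).
rewrite /index_iota subn0 big_seq [leRHS]big_seq le_eqVlt; apply/orP; left.
apply/eqP/eq_bigr => j; rewrite mem_iota add0n /= => jm.
have sL : size L = m.*2 by rewrite size_sort size_iota.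
rewrite qL !(nth_map 0%N) ?sL; [|lia..].
congr (_ ^+ _); have : (nth 0 q (nth 0 L j.*2) <= nth 0 q (nth 0 L j.*2.+1))%N.
  have := sorted_leq_nth leq_trans leqnn 0%N (sort_sorted leq_total q).
  move/(_ j.*2 j.*2.+1); rewrite !inE size_sort qL !(nth_map 0%N) ?sL; [|lia..].
  by apply; lia.
by rewrite /gap; case: (leqP (nth 0%N L j.*2)) => _; lia.
Qed.

(** * Moments of the matrix entries *)

Section Positions.
Context (N : nat) (phi : filling N).

(** The time at which the process provides the matrix entry at [(i, j)]. *)
Definition pos (i j : 'I_N) : nat := fill_inv phi (upper_pair i j).

Lemma pos_sym i j : pos i j = pos j i.
Proof.
rewrite /pos; congr (nat_of_ord (fill_inv _ _)); apply: val_inj.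
by rewrite /= minC maxC.
Qed.

Lemma pos_inj i : injective (pos i).
Proof.
move=> j k /ord_inj /(can_inj (fill_invK phi)) /(congr1 val)[].
rewrite !minEle !maxEle; case: ifP => ij; case: ifP => ik.
- by [].
- by move=> <- ji; exact: esym.
- by move=> ji ik'; rewrite ji ik'.
- by [].
Qed.

End Positions.

Section Moments.
Context (d : measure_display) (T : measurableType d) (R : realType).
Context (P : probability T R) (Z : nat -> {RV P >-> R}).
Hypothesis hint : moments_exist Z.

(** Moments are finite, so inequalities between them can be treated over [R]. *)
Definition mom (q : seq nat) : R := fine (moment Z q).

Lemma momE q : moment Z q = (mom q)%:E.
Proof.
rewrite /mom /moment expectation.unlock fineK//.
exact: integrable_fin_num (hint q).
Qed.

Lemma perm_mom q q' : perm_eq q q' -> mom q = mom q'.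
Proof.
move=> qq'; rewrite /mom /moment; congr (fine (expectation _ _)).
by apply/funext => w; exact: perm_big.
Qed.

Lemma expectation_sum_mom (I : Type) (r : seq I) (A : pred I)
    (q : I -> seq nat) :
  'E_P[fun w => (\sum_(i <- r | A i) \prod_(a <- q i) Z a w)%R]%E =
  (\sum_(i <- r | A i) mom (q i))%:E.
Proof.
rewrite expectation.unlock; under eq_integral do rewrite -sumEFin.
rewrite integral_sum// -sumEFin; apply: eq_bigr => i _.
by rewrite -momE /moment expectation.unlock.
Qed.

Lemma integrable_sum_mom (I : Type) (r : seq I) (A : pred I)
    (q : I -> seq nat) :
  P.-integrable setT
    (fun w => (\sum_(i <- r | A i) \prod_(a <- q i) Z a w)%:E).
Proof.
under eq_fun do rewrite -sumEFin.
by apply: integrable_sum => // i _; exact: hint.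
Qed.

Section Trace.
Context (N : nat) (phi : filling N).

Lemma gen_matrixE w i j : gen_matrix Z phi w i j = Z (pos phi i j) w.
Proof. by rewrite mxE. Qed.

Lemma gen_matrix_sym w : (gen_matrix Z phi w)^T = gen_matrix Z phi w.
Proof. by apply/matrixP => i j; rewrite mxE !gen_matrixE pos_sym. Qed.

Lemma trace_gen_matrix (x0 : 'I_N) n w :
  \tr (gen_matrix Z phi w ^+ n) =
  \sum_(s <- walks N n.+1 | nth x0 s 0 == nth x0 s n)
    \prod_(a <- steps x0 (pos phi) n s) Z a w.
Proof.
rewrite (trace_exp_walks x0); apply: eq_bigr => s _.
by rewrite big_map; apply: eq_bigr => a _; rewrite gen_matrixE.
Qed.

Lemma integrable_trace n :
  P.-integrable setT (fun w => (\tr (gen_matrix Z phi w ^+ n))%:E).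
Proof.
case: (posnP N) => [N0|N0].
  have -> : (fun w => (\tr (gen_matrix Z phi w ^+ n))%:E) = cst 0%E.
    apply/funext => w; congr (_%:E); rewrite /mxtrace big1// => i _.
    by have := ltn_ord i; rewrite {2}N0.
  exact: integrable0.
under eq_fun do rewrite (trace_gen_matrix (Ordinal N0)).
exact: integrable_sum_mom.
Qed.

End Trace.

(** The only input is the decay of the moments in the gaps of the sorted
    indices. It is bounded by a sum over all pairings of the steps, and for each
    pairing the walks, closed or not, contribute [N ^ (m + 1)] up to a
    constant. After normalization the even spectral moments are bounded. *)
Lemma trace_even_moment_le (m : nat) : condM3 Z -> (0 < m)%N ->
  exists2 K : R, 0 <= K & forall N (phi : filling N), (0 < N)%N ->
    ('E_P[fun w => (\tr (gen_matrix Z phi w ^+ m.*2))%R] <=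
     (K * N%:R ^+ m.+1)%:E)%E.
Proof.
move=> hM3 m0; have [||C [b [C0 b01 h3a _ _]]] := hM3 m.*2.
- by rewrite double_gt0.
- by rewrite odd_double.
have b0 : 0 <= b by case/andP: b01.
have K0 : 0 <= 2 / (1 - b).
  by case/andP: b01 => _ b1; rewrite divr_ge0// subr_ge0 ltW.
pose perms := permutations (iota 0 m.*2).
exists (C * (size perms)%:R * (2 / (1 - b)) ^+ m).
  by rewrite !mulr_ge0 ?ler0n ?exprn_ge0// ltW.
move=> N phi N0; pose x0 := Ordinal N0.
under eq_fun do rewrite (trace_gen_matrix phi x0).
rewrite expectation_sum_mom lee_fin.
have mom_le q : size q = m.*2 -> mom q <= C * b ^+ gap_sum (sort leq q).
  move=> sq; have sq' : size (sort leq q) == m.*2 by rewrite size_sort sq.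
  have := h3a (Tuple sq') (sort_sorted leq_total q).
  rewrite /= momE /= lee_fin (@perm_mom _ q) ?perm_sort//.
  exact/le_trans/ler_norm.
apply: (@le_trans _ _ (\sum_(s <- walks N m.*2.+1)
    C * \sum_(L <- perms) pairing_weight b (pairing m L)
                            (steps x0 (pos phi) m.*2 s))).
  rewrite big_mkcond; apply: ler_sum => s _.
  have W0 : 0 <= C * \sum_(L <- perms) pairing_weight b (pairing m L)
                            (steps x0 (pos phi) m.*2 s).
    rewrite mulr_ge0 ?(ltW C0)// sumr_ge0// => L _.
    exact: pairing_weight_ge0.
  case: ifP => // _; apply: le_trans (mom_le _ _) _; first exact: size_steps.
  by rewrite ler_pM2l//; apply: expr_gap_sum_le => //; exact: size_steps.
rewrite -mulr_sumr exchange_big/= -!mulrA ler_pM2l//.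
rewrite -sum1_size natr_sum mulr_suml.
rewrite big_seq [leRHS]big_seq; apply: ler_sum => L.
rewrite mem_permutations mul1r => pL.
apply: le_trans (sum_walks_pairing x0 b01 (@pos_inj _ phi) _ _) _.
- exact: pairing_lt.
- exact: pairing_uniq.
by rewrite size_pairing -addnn -addSn addnK.
Qed.

Definition geometric_fourth_moments (b C : R) : Prop :=
  forall i1 i2 i3 i4 : nat,
  (i1 <= i2)%N -> (i2 <= i3)%N -> (i3 <= i4)%N ->
  ('E_P[fun w => (Z i1 w * Z i2 w * Z i3 w * Z i4 w)%R] =
     (C * b ^+ ((i2 - i1) + (i4 - i3))%N)%R%:E)%E /\
  ('E_P[fun w => (Z i1 w ^+ 2 * Z i2 w ^+ 2)%R] = 1)%E.

Section FourthMoment.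
Context (b C : R).
Hypothesis b01 : 0 < b < 1.
Hypothesis hii : geometric_fourth_moments b C.

(** Ordering the two indices suffices, since the moment is symmetric. *)
Lemma mom_pairs p q : mom [:: p; p; q; q] = 1.
Proof.
wlog pq : p q / (p <= q)%N.
  move=> H; case: (leqP p q) => [|/ltnW] /H // <-.
  by apply: perm_mom; rewrite (perm_catC [:: p; p] [:: q; q]).
apply/eqP; rewrite -eqe; apply/eqP; rewrite -momE.
have [_ <-] := hii pq (leqnn q) (leqnn q).
rewrite /moment; congr (expectation _ _); apply/funext => w.
by rewrite !big_cons big_nil; ring.
Qed.

(** The constant is forced to be [1]: for four equal indices the two fourth
    moment formulas describe the same expectation. *)
Lemma mom4_sorted p q r s : (p <= q)%N -> (q <= r)%N -> (r <= s)%N ->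
  mom [:: p; q; r; s] = b ^+ ((q - p) + (s - r)).
Proof.
have momC i1 i2 i3 i4 : (i1 <= i2)%N -> (i2 <= i3)%N -> (i3 <= i4)%N ->
    mom [:: i1; i2; i3; i4] = C * b ^+ ((i2 - i1) + (i4 - i3)).
  move=> i12 i23 i34; apply/eqP; rewrite -eqe; apply/eqP; rewrite -momE.
  have [<- _] := hii i12 i23 i34.
  rewrite /moment; congr (expectation _ _); apply/funext => w.
  by rewrite !big_cons big_nil; ring.
have C1 : C = 1.
  by have := mom_pairs p p; rewrite momC// subnn expr0 mulr1.
by move=> *; rewrite momC// C1 mul1r.
Qed.

(** Among the pairings of four numbers, the one that matches neighbors in
    sorted order has the least total gap. Any other pairing thus gives a lower
    bound, and in particular all fourth moments are nonnegative. *)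
Lemma mom4_ge p p' q q' :
  b ^+ (gap p p' + gap q q') <= mom [:: p; p'; q; q'].
Proof.
have [b0 b1] := andP b01.
wlog pp' : p p' / (p <= p')%N.
  move=> H; case: (leqP p p') => [/H//|/ltnW /H].
  rewrite (_ : gap p' p = gap p p'); last by rewrite /gap addnC.
  by congr (_ <= _); apply: perm_mom; apply/permP => a /=; lia.
wlog qq' : q q' / (q <= q')%N.
  move=> H; case: (leqP q q') => [/H//|/ltnW /H].
  rewrite (_ : gap q' q = gap q q'); last by rewrite /gap addnC.
  by congr (_ <= _); apply: perm_mom; apply/permP => a /=; lia.
wlog pq : p p' q q' pp' qq' / (p <= q)%N.
  move=> H; case: (leqP p q) => [/(H _ _ _ _ pp' qq')//|/ltnW].
  move=> /(H _ _ _ _ qq' pp'); rewrite addnC.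
  by congr (_ <= _); apply: perm_mom; apply/permP => a /=; lia.
have gapE : (gap p p' + gap q q')%N = ((p' - p) + (q' - q))%N.
  by rewrite /gap; lia.
have sorted_ge r1 r2 r3 r4 : perm_eq [:: p; p'; q; q'] [:: r1; r2; r3; r4] ->
    (r1 <= r2)%N -> (r2 <= r3)%N -> (r3 <= r4)%N ->
    ((r2 - r1) + (r4 - r3) <= gap p p' + gap q q')%N ->
    b ^+ (gap p p' + gap q q') <= mom [:: p; p'; q; q'].
  move=> pr r12 r23 r34 le; rewrite (perm_mom pr) mom4_sorted//.
  by apply: ler_wiXn2l le; rewrite ltW.
rewrite gapE in sorted_ge *.
(* the intervals [p, p'] and [q, q'] are disjoint, overlapping or nested *)
case: (leqP p' q) => p'q; first exact: (sorted_ge p p' q q').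
case: (leqP p' q') => p'q'.
  apply: (sorted_ge p q p' q') => //; [|exact: ltnW|lia].
  by apply/permP => a /=; lia.
apply: (sorted_ge p q q' p') => //; [|exact: ltnW|lia].
by apply/permP => a /=; lia.
Qed.

End FourthMoment.

End Moments.

(** * The surplus in the fourth moment *)

(** Column [j] receives its entries in the consecutive rows [i] and [k] from
    consecutive times. By symmetry of the matrix this also encodes horizontal
    neighbors. *)
Definition adjacent (N : nat) (phi : filling N) (i k j : 'I_N) : bool :=
  (k == i.+1 :> nat) && (gap (pos phi i j) (pos phi j k) == 1)%N.

(** A pair of neighbors filled at times [n] and [n + 1] yields an adjacent
    triple, and [n] is recovered from the triple as the smaller of the two
    times. *)
Lemma num_neighbors_le (N : nat) (phi : filling N) :
  (num_neighbors phi <= \sum_i \sum_k \sum_j adjacent phi i k j)%N.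
Proof.
pose G := [pred t : ('I_N * 'I_N) * 'I_N | adjacent phi t.1.1 t.1.2 t.2].
have -> : (\sum_i \sum_k \sum_j adjacent phi i k j)%N = #|G|.
  rewrite pair_bigA pair_bigA /= -sum1_card [RHS]big_mkcond /=.
  by apply: eq_bigr => -[[i k] j] _; rewrite inE /=; case: adjacent.
pose h (t : ('I_N * 'I_N) * 'I_N) : nat :=
  minn (pos phi t.1.1 t.2) (pos phi t.2 t.1.2).
suff : {subset [seq val n | n in [pred k : 'I_(N * N.+1)./2 |
      [exists l : 'I_(N * N.+1)./2,
        (l == k.+1 :> nat) && neighbors (phi k) (phi l)]]] <=
    [seq h t | t in G]}.
  move=> /uniq_leq_size sub; rewrite /num_neighbors -[leqRHS](size_image h).
  rewrite -[leqLHS](size_image val); apply: sub.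
  by rewrite map_inj_uniq ?enum_uniq//; exact: val_inj.
have pos_fill (n : 'I_(N * N.+1)./2) :
    pos phi (val (phi n)).1 (val (phi n)).2 = n.
  rewrite /pos (_ : upper_pair _ _ = phi n) ?fillK//; apply: val_inj => /=.
  case: (phi n) => -[i j] /= ij; have {}ij : (i <= j)%O by exact: ij.
  by rewrite minEle maxEle ij.
move=> _ /fintype.imageP[n + ->]; rewrite inE => /existsP[l /andP[/eqP ln nb]].
move: nb (pos_fill n) (pos_fill l); rewrite /neighbors.
case: (val (phi n)) => i j; case: (val (phi l)) => i' j' /= nb pn pl.
have mem (i0 k0 j0 : 'I_N) : k0 = i0.+1 :> nat ->
    (pos phi i0 j0 = n /\ pos phi j0 k0 = l) \/
    (pos phi i0 j0 = l /\ pos phi j0 k0 = n) ->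
    val n \in [seq h t | t in G].
  move=> k0E H; apply/fintype.imageP; exists ((i0, k0), j0).
    rewrite inE /adjacent /= k0E eqxx /= /gap.
    by case: H => -[-> ->]; rewrite ln; lia.
  by rewrite /h /=; case: H => -[-> ->]; rewrite ln /=; lia.
case/orP: nb => /andP[/eqP e /orP[]/eqP f]; subst.
- by apply: (mem j' j i') => //; right; rewrite pos_sym.
- by apply: (mem j j' i') => //; left; rewrite pos_sym.
- by apply: (mem i' i j') => //; right; rewrite [pos phi j' i]pos_sym.
- by apply: (mem i i' j') => //; left; rewrite [pos phi j' i']pos_sym.
Qed.

Section Lower.
Context (d : measure_display) (T : measurableType d) (R : realType).
Context (P : probability T R) (Z : nat -> {RV P >-> R}).
Hypothesis hint : moments_exist Z.
Context (b C c : R).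
Hypothesis b01 : 0 < b < 1.
Hypothesis hii : geometric_fourth_moments Z b C.
Context (N : nat) (phi : filling N).
Hypothesis hc : c * N%:R ^+ 2 <= (num_neighbors phi)%:R.
Hypothesis c0 : 0 <= c.

Let p := pos phi.
Let cyc i k j l : seq nat := [:: p i j; p j k; p k l; p l i].

Lemma trace4_gen_matrix w :
  \tr (gen_matrix Z phi w ^+ 4) =
  \sum_i \sum_k \sum_j \sum_l \prod_(a <- cyc i k j l) Z a w.
Proof.
rewrite /mxtrace; apply: eq_bigr => i _.
rewrite (exprD _ 2 2) -mulmxE mxE; apply: eq_bigr => k _.
rewrite expr2 -mulmxE !mxE mulr_suml; apply: eq_bigr => j _.
rewrite mulr_sumr; apply: eq_bigr => l _.
by rewrite !gen_matrixE !big_cons big_nil -/p; ring.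
Qed.

(** The closed walks [i, j, k, l, i] with [i = k] or [j = l] traverse two edges
    back and forth and have expectation [1]: this is the semicircle
    contribution. When [(i, k, j)] and [(i, k, l)] are both adjacent, the four
    entries form two pairs of consecutive variables, of expectation at least
    [b ^ 2]. The subtracted terms compensate for the overlaps of these
    cases, and all other walks contribute something nonnegative. *)
Lemma mom_cycle_ge i k j l :
  (i == k)%:R + (j == l)%:R - ((i == k) && (j == l))%:R +
  b ^+ 2 * ((adjacent phi i k j)%:R * (adjacent phi i k l)%:R) -
  ((k == i.+1 :> nat) && (j == l))%:R <= mom Z (cyc i k j l).
Proof.
have [b0 b1] := andP b01.
have b2 : 0 <= b ^+ 2 <= 1 by rewrite exprn_ge0 ?exprn_ile1// ltW.
have ge0 : 0 <= mom Z (cyc i k j l).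
  by apply: le_trans (mom4_ge hint b01 hii _ _ _ _); rewrite exprn_ge0// ltW.
have [ik|nik] := eqVneq i k.
  subst k; have -> : mom Z (cyc i i j l) = 1.
    by rewrite /cyc [p j i]pos_sym [p l i]pos_sym (mom_pairs hint hii).
  rewrite /adjacent (ltn_eqF (ltnSn i)) /=; case: eqP => _ /=; lra.
have [jl|njl] := eqVneq j l.
  subst l; have -> : mom Z (cyc i k j j) = 1.
    rewrite -(mom_pairs hint hii (p i j) (p k j)).
    rewrite /cyc /p [pos phi j i]pos_sym [pos phi j k]pos_sym.
    by apply: perm_mom; apply/permP => a /=; ring.
  rewrite /adjacent; case: (k == i.+1 :> nat) => /=; last by lra.
  by case: (_ == _) => /=; lra.
rewrite !andbF /=.
have [/andP[/andP[/eqP ki /eqP gj] /andP[_ /eqP gl]]|nadj] :=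
    boolP (adjacent phi i k j && adjacent phi i k l).
  rewrite /adjacent ki gj gl eqxx /= !mulr1.
  suff : b ^+ 2 <= mom Z (cyc i k j l) by lra.
  have gl' : gap (p k l) (p l i) = 1%N.
    by rewrite /p [pos phi k l]pos_sym [pos phi l i]pos_sym -gl /gap addnC.
  by apply: le_trans (mom4_ge hint b01 hii _ _ _ _); rewrite gj gl'.
have -> : (adjacent phi i k j)%:R * (adjacent phi i k l)%:R = 0 :> R.
  by rewrite -natrM mulnb (negPf nadj).
lra.
Qed.

Let sum_cst (x : R) : \sum_(j < N) x = x * N%:R.
Proof. by rewrite sumr_const card_ord mulr_natr. Qed.

(** The walks through adjacent triples contribute [b ^ 2 U ^ 2], where [U] is
    the number of columns adjacent for the rows [i] and [k]. The inequality
    [U ^ 2 >= 2 t U - t ^ 2] at [t = c N] makes this linear in [U], which takes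
    the place of the Cauchy-Schwarz inequality once everything is summed over
    the rows. *)
Lemma sum_mom_cycle_ge i k :
  (i == k)%:R * (N%:R ^+ 2 - N%:R) + N%:R +
  b ^+ 2 * (2 * c * N%:R * \sum_j (adjacent phi i k j)%:R) -
  (k == i.+1 :> nat)%:R * (N%:R + b ^+ 2 * (c * N%:R) ^+ 2) <=
  \sum_j \sum_l mom Z (cyc i k j l).
Proof.
set U := \sum_j _; apply: (@le_trans _ _ (\sum_j \sum_l
  ((i == k)%:R + (j == l)%:R - ((i == k) && (j == l))%:R +
  b ^+ 2 * ((adjacent phi i k j)%:R * (adjacent phi i k l)%:R) -
  ((k == i.+1 :> nat) && (j == l))%:R))); last first.
  by apply: ler_sum => j _; apply: ler_sum => l _; exact: mom_cycle_ge.
have sum_eq (j : 'I_N) : \sum_l (j == l)%:R = 1 :> R.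
  rewrite (bigD1 j)//= eqxx big1 ?addr0// => l; rewrite eq_sym.
  by move=> /negPf ->.
have -> : \sum_j \sum_l
    ((i == k)%:R + (j == l)%:R - ((i == k) && (j == l))%:R +
     b ^+ 2 * ((adjacent phi i k j)%:R * (adjacent phi i k l)%:R) -
     ((k == i.+1 :> nat) && (j == l))%:R) =
    \sum_(j < N) ((i == k)%:R * N%:R + 1 - (i == k)%:R +
      b ^+ 2 * ((adjacent phi i k j)%:R * U) - (k == i.+1 :> nat)%:R) :> R.
  apply: eq_bigr => j _; rewrite !big_split /= !sumrN.
  rewrite !sum_cst sum_eq -mulr_sumr -mulr_sumr.
  congr (_ + _ - _ + _ - _).
    under eq_bigr do rewrite -mulnb natrM.
    by rewrite -mulr_sumr sum_eq mulr1.
  under eq_bigr do rewrite -mulnb natrM.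
  by rewrite -mulr_sumr sum_eq mulr1.
rewrite !big_split /= !sumrN -[\sum_j b ^+ 2 * _]mulr_sumr -mulr_suml -/U.
rewrite !sum_cst.
have key : 2 * c * N%:R * U - (k == i.+1 :> nat)%:R * (c * N%:R) ^+ 2 <= U * U.
  have [ki|nki] := boolP (k == i.+1 :> nat).
    have := sqr_ge0 (U - c * N%:R); rewrite /= mul1r !expr2; lra.
  rewrite /= mul0r subr0 (_ : U = 0) ?mulr0//.
  by rewrite /U big1// => j _; rewrite /adjacent (negPf nki).
have := ler_wpM2l (sqr_ge0 b) key.
lra.
Qed.

(** The first two terms are those of independent entries, up to lower order.
    The third one has the same order [N ^ 3] and comes from the positive
    proportion of neighbors filled consecutively. *)
Lemma trace4_ge :
  ((2 * N%:R ^+ 3 - 2 * N%:R ^+ 2 + b ^+ 2 * c ^+ 2 * N%:R ^+ 3)%:E <=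
   'E_P[fun w => (\tr (gen_matrix Z phi w ^+ 4))%R])%E.
Proof.
under eq_fun do rewrite trace4_gen_matrix !pair_bigA.
rewrite (expectation_sum_mom hint) lee_fin.
have -> : \sum_i mom Z (cyc i.1.1.1 i.1.1.2 i.1.2 i.2) =
    \sum_i \sum_k \sum_j \sum_l mom Z (cyc i k j l) by rewrite !pair_bigA.
pose U i : R := \sum_k \sum_j (adjacent phi i k j)%:R.
have row_ge i : 2 * N%:R ^+ 2 - 2 * N%:R - b ^+ 2 * (c * N%:R) ^+ 2 +
    b ^+ 2 * (2 * c * N%:R * U i) <= \sum_k \sum_j \sum_l mom Z (cyc i k j l).
  apply: (@le_trans _ _ (\sum_k _)); last first.
    by apply: ler_sum => k _; exact: sum_mom_cycle_ge.
  rewrite !big_split /= sumrN -!mulr_suml -!mulr_sumr -/(U i).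
  rewrite !sum_cst.
  have -> : \sum_k (i == k)%:R = 1 :> R.
    rewrite (bigD1 i)//= eqxx big1 ?addr0// => l; rewrite eq_sym.
    by move=> /negPf ->.
  have : \sum_(k < N) (k == i.+1 :> nat)%:R <= 1 :> R.
    have [iN|iN] := ltnP i.+1 N.
      rewrite (bigD1 (Ordinal iN))//= eqxx big1 ?addr0// => l.
      by rewrite -val_eqE /= => /negPf ->.
    rewrite big1// => l _; have := ltn_ord l.
    by case: eqP => // -> ; rewrite ltnNge iN.
  have := sqr_ge0 (c * N%:R); have := sqr_ge0 b; have := ler0n R N.
  set x := \sum_(k < N) _; set B := b ^+ 2; set D := (c * N%:R) ^+ 2.
  move=> N0 B0 D0 x1.
  have Q0 : 0 <= N%:R + B * D by rewrite addr_ge0// mulr_ge0.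
  have := ler_wpM2r Q0 x1.
  lra.
apply: le_trans (ler_sum _ (fun i _ => row_ge i)).
rewrite big_split /= -!mulr_sumr sum_cst.
have sumU : c * N%:R ^+ 2 <= \sum_i U i.
  have -> : \sum_i U i = (\sum_i \sum_k \sum_j adjacent phi i k j)%:R.
    rewrite natr_sum; apply: eq_bigr => i _; rewrite natr_sum.
    by apply: eq_bigr => k _; rewrite natr_sum.
  by apply: le_trans hc _; rewrite ler_nat; exact: num_neighbors_le.
have cN0 : 0 <= b ^+ 2 * (2 * c * N%:R).
  by rewrite mulr_ge0 ?sqr_ge0// mulr_ge0 ?ler0n// mulr_ge0.
have := ler_wpM2l cN0 sumU.
lra.
Qed.

End Lower.

(** * The fourth moment of the semicircle law *)

Section Density.
Context (d : measure_display) (T : measurableType d) (R : realType).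
Context (mu nu : {measure set T -> \bar R}) (g : T -> \bar R).
Hypotheses (g0 : forall x, (0 <= g x)%E) (mg : measurable_fun setT g).
Hypothesis nuE : forall A, measurable A -> nu A = (\int[mu]_(x in A) g x)%E.

Import HBNNSimple.

Lemma integral_nnsfun_density (h : {nnsfun T >-> R}) :
  (\int[nu]_x (h x)%:E = \int[mu]_x ((h x)%:E * g x))%E.
Proof.
have h_ge0 (y : R) x : (0 <= (y * \1_(h @^-1` [set y]) x)%:E)%E.
  by rewrite EFinM; exact: nnfun_muleindic_ge0.
have m_ind (y : R) :
    measurable_fun setT (fun x => (y * \1_(h @^-1` [set y]) x)%:E).
  by apply/measurable_EFinP; exact: measurable_funM.
under eq_integral do rewrite fimfunE -fsumEFin//.
rewrite ge0_integral_fsum//.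
under [RHS]eq_integral do rewrite fimfunE -fsumEFin// ge0_mule_fsuml//.
rewrite ge0_integral_fsum//; last 2 first.
- by move=> y; exact: emeasurable_funM.
- by move=> y x _; exact: mule_ge0.
apply: eq_fsbigr => y; rewrite inE => -[t _ <-].
under eq_integral do rewrite EFinM.
under [RHS]eq_integral do rewrite EFinM -muleA.
have mh : measurable (h @^-1` [set h t]) by exact: measurable_sfunP.
rewrite !ge0_integralZl ?lee_fin//; last 3 first.
- by apply: emeasurable_funM => //; exact/measurable_EFinP.
- by move=> x _; rewrite mule_ge0// lee_fin.
- exact/measurable_EFinP.
congr (_ * _)%E; rewrite integral_indic// setIT nuE//.
rewrite integral_mkcond; apply: eq_integral => x _.
by rewrite epatch_indic muleC.
Qed.

(** Both sides agree on simple functions; a nonnegative function is a limit of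
    simple functions from below. *)
Lemma ge0_integral_density_le (f : T -> \bar R) :
  (forall x, (0 <= f x)%E) -> measurable_fun setT f ->
  (\int[nu]_x f x <= \int[mu]_x (f x * g x))%E.
Proof.
move=> f0 mf; pose h := nnsfun_approx measurableT mf.
have hf x : (h n x)%:E @[n --> \oo] --> f x by exact: cvg_nnsfun_approx.
have nd_h x : nondecreasing_seq (fun n => (h n x)%:E).
  by move=> m n mn; rewrite lee_fin; exact/lefP/nd_nnsfun_approx.
under eq_integral => x _ do rewrite -(cvg_lim _ (hf x))//.
rewrite monotone_convergence//; last 2 first.
- by move=> n; exact/measurable_EFinP.
- by move=> n x _; rewrite lee_fin.
apply: lime_le.
  apply: ereal_nondecreasing_is_cvgn => m n mn; apply: ge0_le_integral => //.
  - by move=> x _; rewrite lee_fin.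
  - exact/measurable_EFinP.
  - exact/measurable_EFinP.
  - by move=> x _; exact: nd_h.
apply: nearW => n; rewrite integral_nnsfun_density.
apply: ge0_le_integral => //.
- by move=> x _; rewrite mule_ge0// lee_fin.
- by apply: emeasurable_funM => //; exact/measurable_EFinP.
- exact: emeasurable_funM.
- move=> x _; rewrite lee_wpmul2r// -(cvg_lim _ (hf x))//.
  apply: lime_ge; first by apply/cvg_ex; exists (f x).
  by exists n => // m /= nm; exact: nd_h.
Qed.

End Density.

Section SemicircleFourth.
Context (R : realType).
Local Notation mu := (@lebesgue_measure R).

Let s (x : R) := Num.sqrt (4 - x ^+ 2).
(** A primitive of [x ^ 4 * s x]. The classical term [4 asin (x / 2)] is written
    with the half-angle formula, which makes [F] continuous on the whole line
    and avoids the arcsine at the endpoints. *)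
Let F (x : R) :=
  (x ^+ 5 / 6 - x ^+ 3 / 6 - x) * s x + 8 * atan (x / (2 + s x)).

Let s0 x : 0 <= s x. Proof. exact: sqrtr_ge0. Qed.
Let s_neq0 x : 2 + s x != 0.
Proof. by rewrite gt_eqF// ltr_pwDl. Qed.

Let cs : continuous s.
Proof.
move=> x; have cq : 4 - y ^+ 2 @[y --> x] --> 4 - x ^+ 2.
  by apply: cvgB; [exact: cvg_cst|exact: exprn_continuous].
exact: (cvg_comp _ _ cq (@sqrt_continuous R _)).
Qed.

Let cF : continuous F.
Proof.
move=> x; apply: cvgD; apply: cvgM.
- apply: cvgB; [apply: cvgB; apply: cvgM|exact: cvg_id]; try exact: cvg_cst.
    exact: exprn_continuous.
  exact: exprn_continuous.
- exact: cs.
- exact: cvg_cst.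
- have cq : y / (2 + s y) @[y --> x] --> x / (2 + s x).
    apply: cvgM; first exact: cvg_id.
    by apply: cvgV => //; apply: cvgD; [exact: cvg_cst|exact: cs].
  exact: (cvg_comp _ _ cq (@continuous_atan R _)).
Qed.

Let dF (x : R) : -2 < x < 2 -> is_derive x 1 F (x ^+ 4 * s x).
Proof.
move=> /andP[x2 x2'].
have r0 : 0 < 4 - x ^+ 2 by nra.
have s2 : s x ^+ 2 = 4 - x ^+ 2 by rewrite sqr_sqrtr// ltW.
have sx0 : 0 < s x by rewrite sqrtr_gt0.
have sx_neq0 : s x != 0 by rewrite gt_eqF.
have Did := is_derive_id x (1 : R).
have Dc (a : R) := is_derive_cst a x (1 : R).
have dq : is_derive x 1 (fun x => 4 - x ^+ 2) (- (2 * x)).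
  apply: (is_derive_eq (is_deriveB (Dc 4) (is_deriveX 2 Did))).
  by rewrite /GRing.scale /=; ring.
have ds : is_derive x 1 s (- x / s x).
  have H : is_derive x 1 s _ :=
    is_derive1_comp (g := fun x => 4 - x ^+ 2) (is_derive1_sqrt r0) dq.
  apply: (is_derive_eq H).
  by rewrite -/(s x); field.
have ds2 : is_derive x 1 (fun x => 2 + s x) (- x / s x).
  by apply: (is_derive_eq (is_deriveD (Dc 2) ds)); rewrite add0r.
have dv := is_deriveV (f := fun x => 2 + s x) (s_neq0 x) ds2.
have dr : is_derive x 1 (fun x => x / (2 + s x)) _ := is_deriveM Did dv.
have da := is_derive1_comp (g := fun x => x / (2 + s x))
  (is_derive1_atan (x / (2 + s x))) dr.
have dp : is_derive x 1 (fun x => x ^+ 5 / 6 - x ^+ 3 / 6 - x)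
   (5 * x ^+ 4 / 6 - 3 * x ^+ 2 / 6 - 1).
  apply: (is_derive_eq (is_deriveB (is_deriveB
    (is_deriveM (is_deriveX 5 Did) (Dc 6^-1))
    (is_deriveM (is_deriveX 3 Did) (Dc 6^-1))) Did)).
  by rewrite /GRing.scale /=; field.
apply: (is_derive_eq (is_deriveD (is_deriveM dp ds) (is_deriveM (Dc 8) da))).
rewrite /GRing.scale /=.
have -> : (1 + (x / (2 + s x)) ^+ 2)^-1 = (2 + s x) / 4.
  have -> : 1 + (x / (2 + s x)) ^+ 2 = 4 / (2 + s x).
    have x2E : x ^+ 2 = 4 - s x ^+ 2 by rewrite s2; ring.
    by rewrite expr_div_n x2E; field; exact: s_neq0.
  by rewrite invf_div.
(* f collects the terms so that x only occurs through x ^ 2 = 4 - u ^ 2 *)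
have u2 := s_neq0 x; move: sx_neq0 u2 s2; set u := s x => u0 u2 s2.
pose f (y : R) := - (y ^+ 3 / 6 - y ^+ 2 / 6 - y) / u +
  u * (5 * y ^+ 2 / 6 - 3 * y / 6 - 1) + 2 * (y / (u * (2 + u)) + 1).
transitivity (f (x ^+ 2)); first by rewrite /f; field; rewrite u0 u2.
have -> : x ^+ 4 = (x ^+ 2) ^+ 2 by ring.
have -> : x ^+ 2 = 4 - u ^+ 2 by rewrite s2; ring.
by rewrite /f; field; rewrite u0 u2.
Qed.

Lemma integral_semicircle_fourth :
  (\int[mu]_x (x ^+ 4 * semicircle_pdf x)%:E = 2%:E)%E.
Proof.
have s2 : s 2 = 0 by rewrite /s (_ : 4 - _ = 0) ?sqrtr0//; ring.
have sN2 : s (-2) = 0 by rewrite /s (_ : 4 - _ = 0) ?sqrtr0//; ring.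
have lt22 : -2 < 2 :> R by lra.
have F2 : F 2 = 2 * pi.
  by rewrite /F s2 mulr0 add0r addr0 divff// atan1; field.
have FN2 : F (-2) = - (2 * pi).
  by rewrite /F sN2 mulr0 add0r addr0 mulNr divff// atanN atan1; field.
transitivity (\int[mu]_(x in `[(-2)%R : R, 2%R])
    ((2 * pi)^-1 * (x ^+ 4 * s x))%:E)%E.
  rewrite [RHS]integral_mkcond; apply: eq_integral => x _.
  rewrite patchE /semicircle_pdf indicE; case: ifPn => _.
    by rewrite mulr1; congr (_%:E); rewrite mulrCA.
  by rewrite mulr0 mulr0.
have c4 : continuous (fun x : R => x ^+ 4 * s x).
  by move=> x; apply: cvgM; [exact: exprn_continuous|exact: cs].
rewrite (@continuous_FTC2 _ _ (fun x => (2 * pi)^-1 * F x)).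
- rewrite F2 FN2 -EFinB; congr (_%:E).
  by move: (@pi R) (lt0r_neq0 (pi_gt0 R)) => p p0; field.
- exact: lt22.
- apply: continuous_subspaceT => x; apply: cvgM; [exact: cvg_cst|exact: c4].
- have cF' x : {for x, continuous (fun x => (2 * pi)^-1 * F x)}.
    by apply: cvgM; [exact: cvg_cst|exact: cF].
  split.
  + move=> x; rewrite in_itv /= => /dF xF.
    by apply: derivableM => //; exact: ex_derive.
  + by apply: cvg_at_right_filter; exact: cF'.
  + by apply: cvg_at_left_filter; exact: cF'.
- move=> x; rewrite in_itv /= => /dF xF; rewrite derive1E.
  have [_ dE] := is_deriveM (is_derive_cst (2 * pi)^-1 x (1 : R)) xF.
  by apply: etrans dE _; rewrite /GRing.scale /= mulr0 addr0.
Qed.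

(** The number [2] is the fourth moment of the law. *)
Lemma semicircle_Rintegral_le (f : R -> R) :
  measurable_fun setT f -> (forall x, 0 <= f x <= x ^+ 4) ->
  \int[@semicircle R]_x f x <= 2.
Proof.
move=> mf f4.
have f0 x : (0 <= (f x)%:E)%E by rewrite lee_fin; case/andP: (f4 x).
have mR (h : R -> R) : measurable_fun setT h ->
    measurable_fun (setT : set (measurableTypeR R)) (EFin \o h).
  move=> mh; apply/measurable_EFinP => _ Y mY; exact: (mh measurableT Y mY).
have mpdf := mR _ (@measurable_semicircle_pdf R).
have : (\int[@semicircle R]_x (f x)%:E <= 2%:E)%E.
  apply: (@le_trans _ _ (\int[mu]_x ((f x)%:E * (semicircle_pdf x)%:E))%E).
    (* Lebesgue measure lives on another copy of the Borel space of R than the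
       semicircle law; the identity transports one to the other. *)
    have mid : measurable_fun [set: R] (idfun : R -> measurableTypeR R).
      exact: measurable_id.
    pose nu := pushforward (@semicircle R) (idfun : R -> measurableTypeR R).
    pose nuM := [the {measure set (measurableTypeR R) -> \bar R} of nu].
    pose nu' := nuM mid.
    have -> : (\int[@semicircle R]_x (f x)%:E = \int[nu']_x (f x)%:E)%E.
      rewrite (ge0_integral_pushforward mid)//; exact/measurable_EFinP.
    apply: (@ge0_integral_density_le _ _ _ mu nu'
      (fun x => (semicircle_pdf x)%:E)) => //.
      by move=> x; rewrite lee_fin semicircle_pdf_ge0.
    exact: mR.
  rewrite -integral_semicircle_fourth; apply: ge0_le_integral => //.
  - by move=> x _; rewrite mule_ge0// lee_fin semicircle_pdf_ge0.
  - by apply: emeasurable_funM; [exact: (mR f)|exact: mpdf].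
  - apply: (mR (fun x => x ^+ 4 * semicircle_pdf x)).
    apply: measurable_funM; last exact: measurable_semicircle_pdf.
    exact: measurable_funX.
  - move=> x _; rewrite -EFinM lee_fin ler_wpM2r ?semicircle_pdf_ge0//.
    by case/andP: (f4 x).
move=> le2; have fin : (\int[@semicircle R]_x (f x)%:E)%E \is a fin_num.
  by rewrite ge0_fin_numE ?integral_ge0// (le_lt_trans le2) ?ltry.
by rewrite /Rintegral -lee_fin fineK.
Qed.

End SemicircleFourth.

(** * Diagonalization and spectral sums *)

Section Diagonalization.
Context (R : realType) (N : nat).
Import sesquilinear spectral complex.

Let toC : {rmorphism R -> R[i]} :=
  [the {rmorphism R -> R[i]} of real_complex R].

Definition simmx (Q X : 'M[R[i]]_N) : 'M[R[i]]_N := invmx Q *m X *m Q.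

Lemma simmxM Q X Y : Q \in unitmx ->
  simmx Q (X *m Y) = simmx Q X *m simmx Q Y.
Proof. by move=> Qu; rewrite /simmx !mulmxA mulmxK. Qed.

Lemma simmx1 Q : Q \in unitmx -> simmx Q 1%:M = 1%:M.
Proof. by move=> Qu; rewrite /simmx mulmx1 mulVmx. Qed.

Lemma simmxX Q X n : Q \in unitmx -> simmx Q X ^+ n = simmx Q (X ^+ n).
Proof.
move=> Qu; elim: n => [|n IH]; first exact/esym/simmx1.
by rewrite !exprS IH -!mulmxE simmxM.
Qed.

Lemma simmx1D Q (c : R[i]) X : Q \in unitmx ->
  simmx Q (1%:M + c *: X) = 1%:M + c *: simmx Q X.
Proof.
move=> Qu; rewrite /simmx mulmxDr mulmxDl mulmx1 mulVmx//.
by rewrite -scalemxAr -scalemxAl.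
Qed.

Definition realdiag (h : 'I_N -> R) : 'M[R[i]]_N :=
  diag_mx (\row_i toC (h i)).

Lemma map_complexX (A : 'M[R]_N) n : map_mx toC (A ^+ n) = map_mx toC A ^+ n.
Proof.
elim: n => [|n IH]; first exact: map_mx1.
by rewrite !exprS -!mulmxE map_mxM IH.
Qed.

Lemma realdiagM h g : realdiag h *m realdiag g = realdiag (fun i => h i * g i).
Proof.
rewrite /realdiag mulmx_diag; congr diag_mx.
by apply/rowP => i; rewrite !mxE rmorphM.
Qed.

Lemma realdiagX h n : realdiag h ^+ n = realdiag (fun i => h i ^+ n).
Proof.
elim: n => [|n IH].
  by rewrite expr0; apply/matrixP => i j; rewrite !mxE rmorph1.
rewrite exprS IH -mulmxE realdiagM; congr realdiag.
by apply/funext => i; rewrite exprS.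
Qed.

Lemma realdiag1D h (e : R) :
  1%:M + toC e *: realdiag h = realdiag (fun i => 1 + e * h i).
Proof.
apply/matrixP => i j; rewrite !mxE rmorphD rmorphM rmorph1.
by case: eqP => // _; rewrite ?mulr1n// !mulr0n mulr0 addr0.
Qed.

(** The spectral theorem diagonalizes over the complex numbers with real
    diagonal entries; these are the eigenvalues up to order because both
    factor the characteristic polynomial. *)
Lemma real_diagonalizable (A : 'M[R]_N) : A^T = A ->
  exists2 Q : 'M[R[i]]_N, Q \in unitmx & exists2 h : 'I_N -> R,
    map_mx toC A = simmx Q (realdiag h) &
    perm_eq [seq h i | i <- enum 'I_N] (eigenvalues A).
Proof.
move=> symA; pose B := map_mx toC A.
have realB : B \is a mxOver Num.real.
  by apply/mxOverP => i j; rewrite mxE; apply/complex_realP; exists (A i j).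
have hermB : B \is hermitianmx N false Num.conj.
  apply: realsym_hermsym => //; apply/is_hermitianmxP.
  by rewrite expr0 scale1r map_mx_id// map_trmx symA.
have realD := hermitian_spectral_diag_real hermB.
have /hermitian_normalmx /orthomx_spectralP eqB := hermB.
pose h i := Re (spectral_diag B 0 i).
exists (spectralmx B); first exact: spectral_unit.
have hB : map_mx toC A = simmx (spectralmx B) (realdiag h).
  suff -> : realdiag h = diag_mx (spectral_diag B) by exact: eqB.
  rewrite /realdiag; congr diag_mx; apply/rowP => i.
  by rewrite mxE /h /= RRe_real//; move/mxOverP: realD.
exists h => //; apply: prod_XsubC_eq.
have [_ <-] := eigenvaluesP symA; apply: (map_poly_inj toC).
rewrite map_char_poly hB char_poly_conjugate ?spectral_unit//.
rewrite char_poly_trig ?diag_mx_is_trig// rmorph_prod/= big_map big_enum /=.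
apply: eq_bigr => i _.
by rewrite rmorphB/= map_polyX map_polyC/= !mxE eqxx mulr1n.
Qed.

Section Traces.
Context (A : 'M[R]_N).
Hypothesis symA : A^T = A.

Let mxtrace_simmx Q X : Q \in unitmx -> \tr (simmx Q X) = \tr X.
Proof. by move=> Qu; rewrite /simmx mxtrace_mulC mulmxA mulmxV// mul1mx. Qed.

Let mxtrace_realdiag h : \tr (realdiag h) = toC (\sum_i h i).
Proof.
rewrite /realdiag mxtrace_diag rmorph_sum /=.
by apply: eq_bigr => i _; rewrite mxE.
Qed.

Lemma trace_exp_eigenvalues n :
  \tr (A ^+ n) = \sum_(x <- eigenvalues A) x ^+ n.
Proof.
have [Q Qu [h AE hE]] := real_diagonalizable symA.
rewrite -(perm_big _ hE) big_map big_enum /=.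
apply: (fmorph_inj toC); rewrite -trace_map_mx map_complexX AE simmxX//.
by rewrite mxtrace_simmx// realdiagX mxtrace_realdiag.
Qed.

Lemma det_1D_exp_gt0 (e : R) : 0 <= e -> 0 < \det (1%:M + e *: A ^+ 4).
Proof.
move=> e0; have [Q Qu [h AE hE]] := real_diagonalizable symA.
suff -> : \det (1%:M + e *: A ^+ 4) = \prod_i (1 + e * h i ^+ 4).
  by apply: prodr_gt0 => i _; rewrite ltr_pwDl// mulr_ge0// exprn_even_ge0.
apply: (fmorph_inj toC); rewrite -det_map_mx map_mxD map_mx1 map_mxZ.
rewrite map_complexX AE (simmxX _ _ Qu) realdiagX.
have -> : 1%:M + toC e *: simmx Q (realdiag (fun i => h i ^+ 4)) =
    simmx Q (realdiag (fun i => 1 + e * h i ^+ 4)).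
  by rewrite -realdiag1D simmx1D.
rewrite /simmx !det_mulmx mulrAC -det_mulmx mulVmx// det1 mul1r.
by rewrite det_diag rmorph_prod /=; apply: eq_bigr => i _; rewrite mxE.
Qed.

(** The sum over the eigenvalues becomes a rational function of the matrix
    entries. This is how its measurability is obtained, without having to show
    that the eigenvalues depend measurably on the matrix. *)
Lemma trace_cap_eigenvalues (e : R) : 0 <= e ->
  \tr (A ^+ 4 *m invmx (1%:M + e *: A ^+ 4)) =
  \sum_(x <- eigenvalues A) x ^+ 4 / (1 + e * x ^+ 4).
Proof.
move=> e0; have [Q Qu [h AE hE]] := real_diagonalizable symA.
set S := 1%:M + _.
have Su : S \in unitmx by rewrite unitmxE unitfE gt_eqF// det_1D_exp_gt0.
pose g i := h i ^+ 4 / (1 + e * h i ^+ 4).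
have A4 : map_mx toC (A ^+ 4) = simmx Q (realdiag (fun i => h i ^+ 4)).
  by rewrite map_complexX AE (simmxX _ _ Qu) realdiagX.
have SE : map_mx toC S = simmx Q (realdiag (fun i => 1 + e * h i ^+ 4)).
  by rewrite map_mxD map_mx1 map_mxZ A4 -realdiag1D simmx1D.
have gE : map_mx toC (A ^+ 4 *m invmx S) = simmx Q (realdiag g).
  have mSu : map_mx toC S \in unitmx by rewrite map_unitmx.
  apply: (can_inj (mulmxK mSu)) => /=.
  rewrite -map_mxM (mulmxKV Su) A4 SE -(simmxM _ _ Qu) realdiagM.
  congr (simmx _ (realdiag _)).
  apply/funext => i; rewrite /g divfK// gt_eqF// ltr_pwDl// mulr_ge0//.
  by rewrite exprn_even_ge0.
rewrite -(perm_big _ hE) big_map big_enum /=.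
apply: (fmorph_inj toC); rewrite -trace_map_mx gE (mxtrace_simmx _ Qu).
by rewrite mxtrace_realdiag.
Qed.

End Traces.

Lemma esd_Rintegral (A : 'M[R]_N) (f : R -> R) :
  measurable_fun setT f -> (forall x, 0 <= f x) ->
  \int[esd A]_x f x = N%:R^-1 * \sum_(x <- eigenvalues A) f x.
Proof.
move=> mf f0.
have mf' : measurable_fun setT (EFin \o f) by exact/measurable_EFinP.
have f0' x : setT x -> (0 <= (f x)%:E)%E by rewrite lee_fin.
rewrite /Rintegral /esd /=.
rewrite ge0_integral_mscale// ge0_integral_measure_sum//.
have di (a : R) : (\int[\d_a]_x (f x)%:E = (f a)%:E)%E.
  by rewrite integral_dirac// diracT mul1e.
rewrite (eq_bigr (fun k : 'I_N => (f (nth 0 (eigenvalues A) k))%:E));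
  last by move=> k _; exact: di.
rewrite sumEFin -EFinM /=; congr (_ * _).
by rewrite (big_nth 0) size_tuple big_mkord.
Qed.

End Diagonalization.

(** * Measurability of matrix-valued maps *)

Section MatrixMeasurability.
Context (d : measure_display) (T : measurableType d) (R : realType).

Definition measurable_mx m n (F : T -> 'M[R]_(m, n)) : Prop :=
  forall i j, measurable_fun setT (fun w => F w i j).

Lemma measurable_mxM m n p (F : T -> 'M[R]_(m, n)) (G : T -> 'M[R]_(n, p)) :
  measurable_mx F -> measurable_mx G -> measurable_mx (fun w => F w *m G w).
Proof.
move=> mF mG i j; under eq_fun do rewrite mxE.
by apply: measurable_sum => k; exact: measurable_funM.
Qed.

Lemma measurable_mxX n (F : T -> 'M[R]_n) k :
  measurable_mx F -> measurable_mx (fun w => F w ^+ k).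
Proof.
move=> mF; elim: k => [|k IH]; first by move=> i j; exact: measurable_cst.
under eq_fun do rewrite exprS -mulmxE; exact: measurable_mxM.
Qed.

Lemma measurable_det n (F : T -> 'M[R]_n) :
  measurable_mx F -> measurable_fun setT (fun w => \det (F w)).
Proof.
move=> mF; apply: measurable_sum => s; apply: measurable_funM => //.
by apply: measurable_prod => i _; exact: mF.
Qed.

Lemma measurable_adjugate n (F : T -> 'M[R]_n) :
  measurable_mx F -> measurable_mx (fun w => \adj (F w)).
Proof.
move=> mF i j; under eq_fun do rewrite mxE /cofactor.
apply: measurable_funM => //; apply: measurable_det => k l.
by under eq_fun do rewrite !mxE; exact: mF.
Qed.

(** The inverse is the adjugate divided by the determinant. The reciprocal of
    the positive determinant is written as a real power, which is measurable. *)
Lemma measurable_invmx n (F : T -> 'M[R]_n) :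
  (forall w, 0 < \det (F w)) -> measurable_mx F ->
  measurable_mx (fun w => invmx (F w)).
Proof.
move=> F0 mF i j.
have -> : (fun w => invmx (F w) i j) =
    (fun w => (\det (F w)) `^ (-1) * \adj (F w) i j).
  apply/funext => w; rewrite /invmx unitmxE unitfE gt_eqF//= mxE.
  by rewrite powR_inv1// ltW.
apply: measurable_funM; last exact: measurable_adjugate.
apply: (measurableT_comp (f := fun x : R => x `^ (-1))).
exact: measurable_powR.
exact: measurable_det.
Qed.

Lemma measurable_mxtrace n (F : T -> 'M[R]_n) :
  measurable_mx F -> measurable_fun setT (fun w => \tr (F w)).
Proof. by move=> mF; apply: measurable_sum => i; exact: mF. Qed.

End MatrixMeasurability.

(** * Normalized spectral moments *)

Section ScaledMatrix.
Context (d : measure_display) (T : measurableType d) (R : realType).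
Context (P : probability T R) (Z : nat -> {RV P >-> R}).
Hypothesis hint : moments_exist Z.
Context (N : nat) (phi : filling N).
Local Notation A := (scaled_matrix Z phi).

Lemma scaled_matrix_sym w : (A w)^T = A w.
Proof. by rewrite /scaled_matrix linearZ /= gen_matrix_sym. Qed.

Lemma trace_scaled_matrix m w :
  \tr (A w ^+ m.*2) = (N%:R ^+ m)^-1 * \tr (gen_matrix Z phi w ^+ m.*2).
Proof.
have scaleX (a : R) n (X : 'M[R]_N) : (a *: X) ^+ n = a ^+ n *: X ^+ n.
  elim: n => [|n IH]; first by rewrite !expr0 scale1r.
  by rewrite !exprS IH -!mulmxE -scalemxAl -scalemxAr scalerA.
rewrite scaleX linearZ /= -mul2n exprM exprVn sqr_sqrtr ?ler0n//.
by rewrite exprVn.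
Qed.

Definition spectral_moment (n : nat) (w : T) : R := N%:R^-1 * \tr (A w ^+ n).

Let spectral_moment_even m : spectral_moment m.*2 =
  (fun w => (N%:R ^+ m.+1)^-1 * \tr (gen_matrix Z phi w ^+ m.*2)).
Proof.
apply/funext => w; rewrite /spectral_moment trace_scaled_matrix mulrA -invfM.
by rewrite exprS.
Qed.

Lemma integrable_spectral_moment m :
  P.-integrable setT (EFin \o spectral_moment m.*2).
Proof.
rewrite spectral_moment_even; apply: eq_integrable; last first.
- exact: (integrableZl measurableT (N%:R ^+ m.+1)^-1
    (integrable_trace hint phi m.*2)).
- by move=> w _ /=; rewrite EFinM.
- by [].
Qed.

Lemma expectation_spectral_moment m : ('E_P[spectral_moment m.*2] =
  ((N%:R ^+ m.+1)^-1)%:E *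
  'E_P[fun w => (\tr (gen_matrix Z phi w ^+ m.*2))%R])%E.
Proof.
rewrite spectral_moment_even expectation.unlock.
under eq_integral do rewrite EFinM.
by rewrite integralZl//; exact: integrable_trace.
Qed.

Lemma measurable_scaled_matrix : measurable_mx A.
Proof.
move=> i j; under eq_fun do rewrite mxE gen_matrixE.
by apply: measurable_funM => //; exact: measurable_funP.
Qed.

End ScaledMatrix.

(** * A bounded substitute for the fourth power *)

Section Cap.
Context (R : realType) (e : R).
Hypothesis e0 : 0 < e.

(** A truncation of [x ^ 4] at height [e^-1]. A rational one is used so that its
    integral against the spectral distribution is the trace of a rational
    function of the matrix. *)
Definition cap (x : R) : R := x ^+ 4 / (1 + e * x ^+ 4).

Let x4 (x : R) : 0 <= x ^+ 4. Proof. exact: exprn_even_ge0. Qed.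

Let den_gt0 x : 0 < 1 + e * x ^+ 4.
Proof. by rewrite ltr_pwDl// mulr_ge0// ltW. Qed.

Lemma cap_ge0 x : 0 <= cap x.
Proof. by rewrite divr_ge0 ?x4// ltW. Qed.

Lemma cap_le x : cap x <= x ^+ 4.
Proof. by rewrite ler_pdivrMr// ler_peMr// lerDl mulr_ge0// ltW. Qed.

Lemma cap_le_inv x : cap x <= e^-1.
Proof.
rewrite ler_pdivrMr// mulrDr mulr1 mulKf ?gt_eqF// lerDr.
by rewrite invr_ge0 ltW.
Qed.

(** The error of the truncation is [e x ^ 8 / (1 + e x ^ 4)]. *)
Lemma fourth_le_cap x : x ^+ 4 <= cap x + e * x ^+ 8.
Proof.
rewrite /cap (_ : x ^+ 8 = x ^+ 4 * x ^+ 4); last by rewrite -exprD.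
have den_ge1 : 1 <= 1 + e * x ^+ 4 by rewrite lerDl mulr_ge0// ltW.
rewrite -(ler_pM2r (den_gt0 x)) mulrDl divfK ?gt_eqF// mulrDr mulr1 lerD2l.
rewrite mulrCA ler_peMr//.
exact: mulr_ge0 (ltW e0) (mulr_ge0 (x4 x) (x4 x)).
Qed.

Lemma cap_continuous : continuous cap.
Proof.
move=> x; apply: cvgM; first exact: exprn_continuous.
apply: cvgV; first by rewrite gt_eqF.
apply: cvgD; first exact: cvg_cst.
by apply: cvgM; [exact: cvg_cst|exact: exprn_continuous].
Qed.

Lemma cap_bounded : bounded_fun cap.
Proof.
exists e^-1; split; first exact: num_real.
move=> M eM x _ /=; rewrite ger0_norm ?cap_ge0//.
exact: le_trans (cap_le_inv x) (ltW eM).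
Qed.

End Cap.

(** * Non-convergence *)

Section NonConvergence.
Context (d : measure_display) (T : measurableType d) (R : realType).
Context (P : probability T R) (Z : nat -> {RV P >-> R}).
Context (phi : forall N : nat, filling N).
Hypothesis hint : moments_exist Z.

(** The surplus [b ^ 2 c ^ 2] of the normalized trace survives up to the error
    [2 / N]; half of it is kept. *)
Lemma fourth_moment_gap (c b C : R) : 0 < c ->
  (forall N : nat, (2 <= N)%N ->
     c * N%:R ^+ 2 <= (num_neighbors (phi N))%:R) ->
  0 < b < 1 ->
  geometric_fourth_moments Z b C ->
  exists2 delta : R, 0 < delta & \forall N \near \oo,
    ((2 + delta)%:E <= 'E_P[spectral_moment Z (phi N) 4])%E.
Proof.
move=> c0 hc b01 hii; have [b0 _] := andP b01.
pose D := b ^+ 2 * c ^+ 2; have D0 : 0 < D by rewrite mulr_gt0// exprn_gt0.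
exists (D / 2); first by rewrite divr_gt0.
near=> N; have N2 : (2 <= N)%N by near: N; exact: nbhs_infty_ge.
have ND : 4 / D <= N%:R by near: N; exact: nbhs_infty_ger.
have N0 : 0 < N%:R :> R by rewrite ltr0n; case: (N) N2.
rewrite (expectation_spectral_moment hint (phi N) 2).
apply: (@le_trans _ _ (((N%:R ^+ 3)^-1)%:E *
    (2 * N%:R ^+ 3 - 2 * N%:R ^+ 2 + D * N%:R ^+ 3)%:E)%E); last first.
  apply: lee_wpmul2l; first by rewrite lee_fin invr_ge0 exprn_ge0// ltW.
  exact: (trace4_ge hint b01 hii (hc _ N2) (ltW c0)).
rewrite -EFinM lee_fin.
have -> : (N%:R ^+ 3)^-1 * (2 * N%:R ^+ 3 - 2 * N%:R ^+ 2 + D * N%:R ^+ 3) =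
    2 + D - 2 / N%:R :> R by field; rewrite gt_eqF.
have : 2 / N%:R <= D / 2.
  by rewrite ler_pdivrMr// -ler_pdivrMl ?divr_gt0// invf_div; move: ND; lra.
lra.
Unshelve. all: by end_near. Qed.

Lemma spectral_moment_bounded m : condM3 Z -> (0 < m)%N ->
  exists2 K : R, 0 <= K & forall N, (0 < N)%N ->
    ('E_P[spectral_moment Z (phi N) m.*2] <= K%:E)%E.
Proof.
move=> hM3 m0; have [K K0 hK] := trace_even_moment_le hint hM3 m0.
exists K => // N N0; rewrite expectation_spectral_moment//.
have NR0 : 0 < N%:R ^+ m.+1 :> R by rewrite exprn_gt0// ltr0n.
apply: (@le_trans _ _ (((N%:R ^+ m.+1)^-1)%:E * (K * N%:R ^+ m.+1)%:E)%E).
  by apply: lee_wpmul2l; [rewrite lee_fin invr_ge0 ltW|exact: hK].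
by rewrite -EFinM lee_fin mulrC mulfK// gt_eqF.
Qed.

Section Truncation.
Context (e : R) (N : nat).
Hypotheses (e0 : 0 < e) (N0 : (0 < N)%N).
Local Notation A := (scaled_matrix Z (phi N)).
Local Notation Y w := (\int[esd (A w)]_x cap e x).

Let mcap : measurable_fun setT (cap e).
Proof. exact: (continuous_measurable_fun (cap_continuous e0)). Qed.

Let YE w : Y w = N%:R^-1 * \sum_(x <- eigenvalues (A w)) cap e x.
Proof. by rewrite esd_Rintegral// => x; exact: cap_ge0. Qed.

Lemma measurable_esd_cap : measurable_fun setT (fun w => Y w).
Proof.
under eq_fun do
  rewrite YE -(trace_cap_eigenvalues (scaled_matrix_sym _ _ _) (ltW e0)).
have mA := measurable_scaled_matrix Z (phi N).
apply: measurable_funM => //; apply: measurable_mxtrace; apply: measurable_mxM.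
  exact: measurable_mxX.
apply: measurable_invmx => [w|i j].
  by apply: det_1D_exp_gt0; [exact: scaled_matrix_sym|exact: ltW].
under eq_fun do rewrite mxE [X in _ + X]mxE.
apply: measurable_funD => //; apply: measurable_funM => //.
exact: measurable_mxX.
Qed.

Lemma esd_cap_le w : Y w <= e^-1.
Proof.
rewrite YE mulrC ler_pdivrMr ?ltr0n//.
apply: (@le_trans _ _ (\sum_(x <- eigenvalues (A w)) e^-1)).
  by apply: ler_sum => x _; exact: cap_le_inv.
by rewrite big_const_seq count_predT size_tuple iter_addr addr0 mulr_natr.
Qed.

Lemma fourth_moment_le_cap w :
  spectral_moment Z (phi N) 4 w <= Y w + e * spectral_moment Z (phi N) 8 w.
Proof.
rewrite YE /spectral_moment !(trace_exp_eigenvalues (scaled_matrix_sym _ _ _)).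
rewrite mulrCA -mulrDr ler_wpM2l ?invr_ge0//.
rewrite mulr_sumr -big_split; apply: ler_sum => x _; exact: fourth_le_cap.
Qed.

(** Off the event of a deviation larger than [eta] the truncated fourth moment
    is at most [c + eta]; on that event it is at most [e^-1]. The eighth moment
    pays for the truncation. *)
Lemma expectation_fourth_moment_le (c eta K p : R) : 0 <= c -> 0 <= eta ->
  ('E_P[spectral_moment Z (phi N) 8] <= K%:E)%E ->
  (P [set w | (eta < `|Y w - c|)%R] <= p%:E)%E ->
  ('E_P[spectral_moment Z (phi N) 4] <= (c + eta + e^-1 * p + e * K)%:E)%E.
Proof.
move=> c0 eta0 hK hp; set S := [set w | _] in hp.
have mS : measurable S.
  have mY : measurable_fun setT (fun w => `|Y w - c|).
    apply: measurableT_comp => //; apply: measurable_funB => //.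
    exact: measurable_esd_cap.
  have -> : S = setT `&` (fun w => `|Y w - c|) @^-1` `]eta, +oo[%classic.
    by rewrite setTI; apply/seteqP; split => w /=; rewrite in_itv /= andbT.
  by apply: mY => //; exact: measurable_itv.
have int4 := integrable_spectral_moment hint (phi N) 2.
have int8 := integrable_spectral_moment hint (phi N) 4.
pose g w : \bar R := ((c + eta)%:E + (e^-1)%:E * (\1_S w)%:E +
  e%:E * (spectral_moment Z (phi N) 8 w)%:E)%E.
have int_ind : P.-integrable setT (fun w => (\1_S w)%:E).
  exact: integrable_indic.
have int_cst : P.-integrable setT (fun=> (c + eta)%:E).
  exact: finite_measure_integrable_cst.
have int_indZ := integrableZl measurableT e^-1 int_ind.
have int1 := integrableD measurableT int_cst int_indZ.
have int2 := integrableZl measurableT e int8.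
have int_g : P.-integrable setT g := integrableD measurableT int1 int2.
apply: (@le_trans _ _ (\int[P]_w g w)%E).
  rewrite expectation.unlock; apply: le_integral => // w _.
  rewrite /g -!EFinM -!EFinD lee_fin.
  apply: le_trans (fourth_moment_le_cap w) _; rewrite lerD2r.
  rewrite indicE; have [wS|] := boolP (w \in S).
    by rewrite mulr1 ler_wpDl ?esd_cap_le// addr_ge0.
  rewrite mulr0 addr0 notin_setE /S /= => /negP; rewrite -leNgt.
  by move=> /(le_trans (ler_norm _)); rewrite lerBlDl.
have cstE : (\int[P]__ (c + eta)%:E = (c + eta)%:E)%E.
  by have := expectation_cst P (c + eta); rewrite expectation.unlock.
rewrite /g integralD//= integralD//= cstE !integralZl//.
rewrite integral_indic// setIT.
rewrite [in leRHS]EFinD [in leRHS]EFinD !EFinM; apply: leeD; last first.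
  rewrite lee_wpmul2l ?lee_fin ?(ltW e0)//.
  by move: hK; rewrite expectation.unlock.
by rewrite leeD2l// lee_wpmul2l// lee_fin invr_ge0 ltW.
Qed.

End Truncation.
End NonConvergence.

Theorem proposition2p8 (d : measure_display) (T : measurableType d)
  (R : realType) (P : probability T R) (Z : nat -> {RV P >-> R})
  (phi : forall N : nat, filling N)
  (hint : moments_exist Z) (hM1 : condM1 Z) (hM2 : condM2 Z) (hM3 : condM3 Z)
  (hi : exists c : R, 0 < c /\
    forall N : nat, (2 <= N)%N -> c * N%:R ^+ 2 <= (num_neighbors (phi N))%:R)
  (hii : exists b C : R, [/\ 0 < b < 1, 0 < C &
    forall i1 i2 i3 i4 : nat, (i1 <= i2)%N -> (i2 <= i3)%N -> (i3 <= i4)%N ->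
      ('E_P[fun w => (Z i1 w * Z i2 w * Z i3 w * Z i4 w)%R] =
         (C * b ^+ ((i2 - i1) + (i4 - i3))%N)%R%:E)%E /\
      ('E_P[fun w => (Z i1 w ^+ 2 * Z i2 w ^+ 2)%R] = 1)%E]) :
  ~ ('E_P[fun w => (N%:R^-1 * \tr (scaled_matrix Z (phi N) w ^+ 4))%R]%E
       @[N --> \oo] --> (catalan R 2)%:E) /\
  ~ weak_cvg_in_probability P
      (fun N w => esd (scaled_matrix Z (phi N) w)) (@semicircle R).
Proof.
have [c [c0 hc]] := hi; have [b [C [b01 C0 hii']]] := hii.
have [delta delta0 gap_near] := fourth_moment_gap hint c0 hc b01 hii'.
split.
  have -> : catalan R 2 = 2 by rewrite /catalan /= (_ : 'C(4, 2) = 6)//; field.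
  move=> cv; have : ((2 + delta)%:E <= 2%:E)%E.
    have cvE := cvg_lim (@ereal_hausdorff R) cv.
    rewrite -cvE; apply: lime_ge; first by apply/cvg_ex; exists 2%:E.
    exact: gap_near.
  by rewrite lee_fin; lra.
have [K K0 hK] := spectral_moment_bounded phi hint (m := 4) hM3 isT.
(* Each of the three error terms, from the truncation, the deviation and its
   probability, is to use at most a quarter of delta. *)
pose e := delta / (4 * (K + 1)).
have K1 : 0 < K + 1 by rewrite ltr_pwDr.
have e0 : 0 < e by rewrite divr_gt0// mulr_gt0.
have eta0 : 0 < delta / 4 by rewrite divr_gt0.
have eK : e * K <= delta / 4.
  rewrite /e invfM mulrA -[_ * _ * K]mulrA ler_piMr ?(ltW eta0)//.
  by rewrite mulrC ler_pdivrMr// mul1r lerDl.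
move=> /(_ (cap e) (cap_continuous e0) (cap_bounded e0) (delta / 4) eta0).
set nu := \int[_]_x cap e x => cvP.
have nu0 : 0 <= nu by apply: Rintegral_ge0 => x _; exact: cap_ge0.
have nu2 : nu <= 2.
  apply: semicircle_Rintegral_le => [|x]; last by rewrite cap_ge0//= cap_le.
  exact: (continuous_measurable_fun (cap_continuous e0)).
have p0 : 0 < e * (delta / 4) by rewrite mulr_gt0.
have P_near : \forall N \near \oo, (P [set w | (delta / 4 <
    `|\int[esd (scaled_matrix Z (phi N) w)]_x cap e x - nu|)%R] <=
    (e * (delta / 4))%:E)%E.
  apply: (cvP [set x : \bar R | (x <= (e * (delta / 4))%:E)%E]).
  by apply: filterS (open_ereal_lt' (_ : 0 < (e * (delta / 4))%:E)%E) =>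
    [x /ltW|].
near \oo => N.
have N0 : (0 < N)%N by near: N; exact: nbhs_infty_gt.
have hp : (P [set w | (delta / 4 <
    `|\int[esd (scaled_matrix Z (phi N) w)]_x cap e x - nu|)%R] <=
    (e * (delta / 4))%:E)%E by near: N.
have hgap : ((2 + delta)%:E <= 'E_P[spectral_moment Z (phi N) 4])%E by near: N.
have := le_trans hgap
  (expectation_fourth_moment_le hint e0 N0 nu0 (ltW eta0) (hK N N0) hp).
rewrite lee_fin mulKf ?gt_eqF//; lra.
Unshelve. all: by end_near. Qed.
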